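(* Let $Q(\tau)=\theta\begin{bmatrix}3/5\\3/5\end{bmatrix}(0,\tau)\,\theta\begin{bmatrix}3/5\\7/5\end{bmatrix}(0,\tau)$. For every $M=\begin{pmatrix} a&b\\ c&d\end{pmatrix}\in\Gamma_{\theta,5}$ and $\tau\in\mathscr{H}$, $Q(M\tau)=\nu(M)(c\tau+d)Q(\tau)$ with $\nu(M)=\nu_\eta^6(M)\exp\!\left(\frac{\pi i}{5}E\right)$, where $E=-\frac{6b}{5}-\frac{2ab}{5}-\frac{2cd}{5}$ if $M\equiv\begin{pmatrix}1&0\\0&1\end{pmatrix}\pmod 5$; $E=-\frac{24b}{5}-\frac{2ab}{5}-\frac{2cd}{5}$ if $M\equiv\begin{pmatrix}-1&0\\0&-1\end{pmatrix}\pmod 5$; $E=-5-\frac{6d}{5}-\frac{2ab}{5}-\frac{2cd}{5}$ if $M\equiv\begin{pmatrix}0&-1\\1&0\end{pmatrix}\pmod 5$; $E=-5+\frac{6d}{5}-\frac{2ab}{5}-\frac{2cd}{5}$ if $M\equiv\begin{pmatrix}0&1\\-1&0\end{pmatrix}\pmod 5$.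
   Context: $\mathscr{H}$ is the upper half plane, $M\tau=\frac{a\tau+b}{c\tau+d}$. $\theta\begin{bmatrix}\epsilon\\ \epsilon'\end{bmatrix}(v,\tau)=\sum_{n\in\mathbb{Z}}\exp\!\Big(2\pi i\Big[\tfrac12\big(n+\tfrac{\epsilon}{2}\big)^2\tau+\big(n+\tfrac{\epsilon}{2}\big)\big(v+\tfrac{\epsilon'}{2}\big)\Big]\Big)$. $\Gamma_{\theta,5}=\{M\in SL(2,\mathbb{Z}): M\equiv\pm\begin{pmatrix}1&0\\0&1\end{pmatrix}\text{ or }\pm\begin{pmatrix}0&-1\\1&0\end{pmatrix}\pmod 5\}$. $\eta(\tau)=q^{1/24}\prod_{n\ge1}(1-q^n)$, $q=e^{2\pi i\tau}$; $\nu_\eta$ is its multiplier system, $\eta(M\tau)=\nu_\eta(M)(c\tau+d)^{1/2}\eta(\tau)$ with branch $-\pi\le\arg(c\tau+d)<\pi$; explicitly $\nu_\eta(M)=\left(\frac{d}{c}\right)^{*}\exp\{\frac{\pi i}{12}[(a+d)c-bd(c^2-1)-3c]\}$ if $c$ odd, $\nu_\eta(M)=\left(\frac{c}{d}\right)_{*}\exp\{\frac{\pi i}{12}[(a+d)c-bd(c^2-1)+3d-3-3cd]\}$ if $c$ even, with $\left(\frac{c}{d}\right)^{*}=\left(\frac{c}{|d|}\right)$, $\left(\frac{c}{d}\right)_{*}=\left(\frac{c}{|d|}\right)(-1)^{\frac{\operatorname{sign}c-1}{2}\frac{\operatorname{sign}d-1}{2}}$ (Jacobi symbols). *)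

(* Defs.v *)
From HB Require Import structures.
From mathcomp Require Import all_boot all_order all_algebra.
From mathcomp Require Import all_classical all_reals all_analysis.
From mathcomp Require Import complex.
Set Implicit Arguments.
Unset Strict Implicit.
Unset Printing Implicit Defensive.
Import Order.TTheory GRing.Theory Num.Theory.
Import numFieldNormedType.Exports.
Local Open Scope ring_scope.

Section Defs.
Variable R : realType.
Local Notation C := (R[i]).

Definition cexp (z : C) : C :=
  let: Complex x y := z in Complex (expR x * cos y) (expR x * sin y).

Definition epi (r : R) : C := cexp (Complex 0 (pi * r)).

Definition upper (tau : C) : Prop := 0 < complex.Im tau.

Definition mobius (a b c d : int) (tau : C) : C :=
  ((a%:~R) * tau + b%:~R) / ((c%:~R) * tau + d%:~R).

Definition legendre (a : int) (p : nat) : int :=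
  if (p%:Z %| a)%Z then 0
  else if [exists x : 'I_p, ((x%:Z) ^+ 2 == a %[mod p%:Z])%Z] then 1 else -1.

Definition jacobi (a : int) (n : nat) : int :=
  \prod_(p <- primes n) legendre a p ^+ logn p n.

(* sign with the (Knopp) convention needed here: sign c := 1 if c > 0, -1 otherwise;
   this makes (0/-1)_* = -1, i.e. nu_eta(-I) = i *)
Definition sgn_star (c : int) : int := if 0 < c then 1 else -1.

Definition jac_up (c d : int) : int := jacobi c `|d|%N.
(* (c/d)_* = (c/|d|) (-1)^{(sign c - 1)/2 * (sign d - 1)/2} *)
Definition jac_down (c d : int) : int :=
  jacobi c `|d|%N * (if (sgn_star c < 0) && (sgn_star d < 0) then -1 else 1).

Definition nu_eta (a b c d : int) : C :=
  if odd `|c|%N then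
    (jac_up d c)%:~R * epi (((a + d) * c - b * d * (c ^+ 2 - 1) - 3 * c)%:~R / 12)
  else
    (jac_down c d)%:~R *
      epi (((a + d) * c - b * d * (c ^+ 2 - 1) + 3 * d - 3 - 3 * c * d)%:~R / 12).

Definition cong5 (x y : int) : bool := (x == y %[mod 5])%Z.

Definition congI (a b c d : int) := [&& cong5 a 1, cong5 b 0, cong5 c 0 & cong5 d 1].
Definition congmI (a b c d : int) := [&& cong5 a (-1), cong5 b 0, cong5 c 0 & cong5 d (-1)].
Definition congS (a b c d : int) := [&& cong5 a 0, cong5 b (-1), cong5 c 1 & cong5 d 0].
Definition congmS (a b c d : int) := [&& cong5 a 0, cong5 b 1, cong5 c (-1) & cong5 d 0].

Definition Gamma_theta5 (a b c d : int) : Prop :=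
  a * d - b * c = 1 /\
  (congI a b c d \/ congmI a b c d \/ congS a b c d \/ congmS a b c d).

(* the exponent E (cases are mutually exclusive) *)
Definition E_exp (a b c d : int) : R :=
  let ab : R := (a * b)%:~R in let cd : R := (c * d)%:~R in
  if congI a b c d then - (6 * b%:~R) / 5 - 2 * ab / 5 - 2 * cd / 5
  else if congmI a b c d then - (24 * b%:~R) / 5 - 2 * ab / 5 - 2 * cd / 5
  else if congS a b c d then - 5 - (6 * d%:~R) / 5 - 2 * ab / 5 - 2 * cd / 5
  else - 5 + (6 * d%:~R) / 5 - 2 * ab / 5 - 2 * cd / 5.

Definition nu (a b c d : int) : C :=
  nu_eta a b c d ^+ 6 * epi (E_exp a b c d / 5).

Definition theta_term (e e' : R) (tau : C) (n : int) : C :=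
  let x : R := n%:~R + e / 2 in
  cexp (Complex 0 (2 * pi) * (Complex (x ^+ 2 / 2) 0 * tau + Complex (x * (e' / 2)) 0)).

Definition theta_partial (e e' : R) (tau : C) (N : nat) : C :=
  \sum_(k < (2 * N).+1) theta_term e e' tau (k%:Z - N%:Z).

Definition theta0 (e e' : R) (tau : C) : C :=
  Complex (limn (fun N => complex.Re (theta_partial e e' tau N)))
          (limn (fun N => complex.Im (theta_partial e e' tau N))).

Definition Qfun (tau : C) : C :=
  theta0 (3 / 5) (3 / 5) tau * theta0 (3 / 5) (7 / 5) tau.

End Defs.

(* Main.v *)
Require Import Defs.
From HB Require Import structures.
From mathcomp Require Import all_boot all_order all_algebra.
From mathcomp Require Import all_classical all_reals all_analysis.
From mathcomp Require Import complex.
From mathcomp Require Import ring lra zify.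
Import Order.TTheory GRing.Theory Num.Theory.
Import numFieldNormedType.Exports.
Local Open Scope complex_scope.
Local Open Scope ring_scope.
Set Implicit Arguments.
Unset Strict Implicit.
Unset Printing Implicit Defensive.
Local Notation Re := complex.Re.
Local Notation Im := complex.Im.

(** With [K_(x,y)(tau) = e^(-pi i (xy + x)) theta[1 + 2x; 1 + 2y](0, tau)], products of two
    such functions satisfy
      [K_v K_w (M tau) = nu_eta(M)^6 (c tau + d) K_(vM) K_(wM) (tau)]
    for all real row vectors [v], [w] and all [M] in SL(2,Z).  This is checked on the translations
    and on [tau -> -1/tau] and propagated by the Euclidean algorithm on [(c, d)]; that
    [nu_eta^6] has the right cocycle property is a computation modulo 4.  Up to a constant,
    [Q] is [K_v K_w] with [v = (-1/5, -1/5)], [w = (-1/5, 1/5)], and for [M] in Gamma_(theta,5)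
    the vectors [vM], [wM] are, up to sign, order and integer translations, [v] and [w] again.

    The inversion formula of theta is Poisson summation for [e^(-pi (lam x + s)^2)], complex
    [lam] and [s].  It is obtained without integrals: the discrete Fourier transform over
    [Z/N] expresses the sum over [Z] through Riemann sums of step [1/N] of translated Gaussians,
    and these Riemann sums, multiplied by [lam], are independent of [lam] and [s] up to [O(1/N)]. *)

(** * Complex exponential *)

(** The normalisation comes from Klein forms: e^(-pi i (xy + x)) theta[1 + 2x; 1 + 2y](0, tau)
    equals e^(pi i x (x tau + y)) theta[1; 1](x tau + y, tau), which is up to a constant eta(tau)^3
    times the Klein form of the point x tau + y. Klein forms obey k_v(M tau) = (c tau + d)^-1
    k_(vM)(tau) without any phase, so two of them leave exactly nu_eta^6 and one factor c tau + d.
    Taking two at a time also means that inversion involves only the square lam^2 = -i tau of a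
    root, so no branch of (c tau + d)^(1/2) has to be followed, and that the Jacobi symbols
    disappear from the multiplier.

    The obstacle in the Poisson formula is the passage to the limit. The O(1/N) comparison of
    Riemann sums has constants depending on the frequency k, while the number of frequencies grows
    with N. A bound of order k^-2 on the averages at frequency k, uniform in N, lets the tail be cut
    off before N tends to infinity. *)

Section ComplexExp.
Variable R : realType.
Implicit Types (x y t : R) (z w : R[i]).

Definition cabs (z : R[i]) : R := Normc.normc z.
Arguments cabs : simpl never.

Lemma cabsM z w : cabs (z * w) = cabs z * cabs w.
Proof. exact: Normc.normcM. Qed.

Lemma cabsD z w : cabs (z + w) <= cabs z + cabs w.
Proof. exact: le_normcD. Qed.

Lemma cabsN z : cabs (- z) = cabs z.
Proof. exact: normcN. Qed.

Lemma cabsB z w : cabs (z - w) <= cabs z + cabs w.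
Proof. by apply: (le_trans (cabsD _ _)); rewrite cabsN. Qed.

Lemma cabs_distC z w : cabs (z - w) = cabs (w - z).
Proof. by rewrite -opprB cabsN. Qed.

Lemma cabs0 : cabs 0 = 0.
Proof. exact: Normc.normc0. Qed.

Lemma cabs_eq0 z : cabs z = 0 -> z = 0.
Proof. exact: Normc.eq0_normc. Qed.

Lemma cabs_ge0 z : 0 <= cabs z.
Proof. by case: z => a b; exact: sqrtr_ge0. Qed.

Lemma cabs_real x : cabs x%:C%C = `|x|.
Proof. by rewrite /cabs /= expr0n /= addr0 sqrtr_sqr. Qed.

Lemma cabs_sqr z : cabs z ^+ 2 = Re z ^+ 2 + Im z ^+ 2.
Proof. by case: z => a b; rewrite /cabs /= sqr_sqrtr // addr_ge0 // sqr_ge0. Qed.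

Lemma le_Re_cabs z : `|Re z| <= cabs z.
Proof.
rewrite -(@ler_pXn2r _ 2) ?nnegrE ?normr_ge0 ?cabs_ge0 // cabs_sqr -normrX.
by rewrite ger0_norm ?sqr_ge0 // lerDl sqr_ge0.
Qed.

Lemma le_Im_cabs z : `|Im z| <= cabs z.
Proof.
rewrite -(@ler_pXn2r _ 2) ?nnegrE ?normr_ge0 ?cabs_ge0 // cabs_sqr -normrX.
by rewrite ger0_norm ?sqr_ge0 // lerDr sqr_ge0.
Qed.

Lemma cabs_le_ReIm z : cabs z <= `|Re z| + `|Im z|.
Proof.
rewrite -(@ler_pXn2r _ 2) ?nnegrE ?addr_ge0 ?normr_ge0 ?cabs_ge0 // cabs_sqr.
rewrite -(real_normK (num_real (Re z))) -(real_normK (num_real (Im z))).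
have := normr_ge0 (Re z); have := normr_ge0 (Im z); nra.
Qed.

Lemma cabs_sum (I : Type) (r : seq I) (P : pred I) (f : I -> R[i]) :
  cabs (\sum_(i <- r | P i) f i) <= \sum_(i <- r | P i) cabs (f i).
Proof.
elim/big_ind2: _ => [|x1 x2 y1 y2 h1 h2|//]; first by rewrite cabs0.
by apply: (le_trans (cabsD _ _)); rewrite lerD.
Qed.

Lemma cexpD z w : cexp (z + w) = cexp z * cexp w.
Proof.
case: z => a b; case: w => c d.
apply/eqP; rewrite eq_complex /= expRD cosD sinD; apply/andP; split; apply/eqP; ring.
Qed.

Lemma cexp0 : cexp (0 : R[i]) = 1.
Proof. by apply/eqP; rewrite eq_complex /= expR0 cos0 sin0 mulr0 mulr1 !eqxx. Qed.

Lemma cexp_neq0 z : cexp z != 0.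
Proof.
have h : cexp (- z) * cexp z = 1 by rewrite -cexpD addNr cexp0.
by apply: contra_eq_neq h => ->; rewrite mulr0 eq_sym oner_neq0.
Qed.

Lemma cexpN z : cexp (- z) = (cexp z)^-1.
Proof. by apply: (mulIf (cexp_neq0 z)); rewrite -cexpD addNr cexp0 mulVf ?cexp_neq0. Qed.

Lemma cabs_cexp z : cabs (cexp z) = expR (Re z).
Proof.
case: z => a b; apply/eqP; rewrite -(@eqrXn2 _ 2) ?cabs_ge0 ?expR_ge0 //.
by rewrite cabs_sqr /= !exprMn -mulrDr cos2Dsin2 mulr1.
Qed.

Lemma epiD x y : epi (x + y) = epi x * epi y.
Proof. by rewrite /epi -cexpD; congr cexp; apply/eqP; rewrite eq_complex /= addr0 mulrDr !eqxx. Qed.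

Lemma epi0 : epi (0 : R) = 1.
Proof. by rewrite /epi mulr0 cexp0. Qed.

Lemma epi1 : epi (1 : R) = -1.
Proof. by apply/eqP; rewrite /epi mulr1 eq_complex /= expR0 cospi sinpi mulr0 !mul1r oppr0 !eqxx. Qed.

Lemma epiN x : epi (- x) = (epi x)^-1.
Proof. by rewrite /epi -cexpN; congr cexp; apply/eqP; rewrite eq_complex /= oppr0 mulrN !eqxx. Qed.

Lemma epi_half : epi (1 / 2 : R) = 'i%C.
Proof.
apply/eqP; rewrite /epi eq_complex /= expR0 !mul1r.
by rewrite cos_pihalf sin_pihalf !eqxx.
Qed.

Lemma epiX x n : epi x ^+ n = epi (x *+ n).
Proof. by elim: n => [|n IH]; rewrite ?expr0 ?mulr0n ?epi0 // exprS IH -epiD mulrS. Qed.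

Lemma sin_le_norm x : `|sin x| <= `|x|.
Proof.
wlog x0 : x / 0 <= x => [hw|].
  case: (lerP 0 x) => [/hw //|x0].
  by rewrite -[sin x]opprK -sinN normrN -[X in _ <= X]normrN; apply: hw; lra.
rewrite [X in _ <= X]ger0_norm //.
have := @MVT_segment R sin cos 0 x x0.
case=> [|c _].
  by apply: continuous_subspaceT => ?; exact: continuous_sin.
rewrite sin0 !subr0 => ->; rewrite normrM (ger0_norm x0) -[X in _ <= X]mul1r.
by rewrite ler_wpM2r // cos_max.
Qed.

Lemma one_sub_cos x : 1 - cos x = 2 * sin (x / 2) ^+ 2.
Proof.
rewrite [in LHS](splitr x) -mulr2n cos_mulr2n cos2sin2 -mulr_natr; ring.
Qed.

Lemma cos_sub1_bound x : `|cos x - 1| <= x ^+ 2 / 2.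
Proof.
rewrite -normrN opprB one_sub_cos ger0_norm; last by rewrite mulr_ge0 // sqr_ge0.
have := sin_le_norm (x / 2); rewrite -(@ler_pXn2r _ 2) ?nnegrE // !real_normK ?num_real //.
rewrite exprMn => h; rewrite (_ : x ^+ 2 / 2 = 2 * (x ^+ 2 * 2^-1 ^+ 2)); last by field.
by rewrite ler_wpM2l.
Qed.

Lemma sin_sub_bound x : `|sin x - x| <= x ^+ 2.
Proof.
wlog x0 : x / 0 <= x => [hw|].
  case: (lerP 0 x) => [/hw //|x0].
  have := hw (- x); rewrite sinN sqrrN -opprD normrN; apply; lra.
have := @MVT_segment R (fun x => sin x - x) (fun x => cos x - 1) 0 x x0.
case=> [|c].

- apply: continuous_subspaceT => y; apply: cvgB; [exact: continuous_sin|exact: cvg_id].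
rewrite in_itv /= => /andP[c0 cx].
rewrite sin0 !subr0 => ->; rewrite normrM (ger0_norm x0).
(* Up to 2, [c <= x <= 2] gives [c ^+ 2 / 2 <= x]; beyond 2 the trivial bound [|cos c - 1| <= 2] is
   enough. *)
case: (lerP x 2) => hx.
  have := cos_sub1_bound c => h; rewrite expr2 ler_wpM2r //; apply: (le_trans h); nra.
have h : `|cos c - 1| <= 2.
  by apply: (le_trans (ler_normB _ _)); rewrite normr1; have := cos_max c; lra.
by rewrite expr2 ler_wpM2r //; lra.
Qed.

Lemma expR_sub1_bound x : `|expR x - 1| <= `|x| * expR `|x|.
Proof.
have h y : expR y - 1 <= y * expR y.
  have := expR_ge1Dx (- y); rewrite expRN => h.
  have e0 := expR_gt0 y.
  have : (1 - y) * expR y <= 1 by rewrite -ler_pdivlMr // mul1r.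
  by lra.
have [x0|x0] := lerP 0 x.
  have e1 : 1 <= expR x by rewrite -[X in X <= _]expR0 ler_expR.
  by rewrite [X in X <= _]ger0_norm ?subr_ge0 // (ger0_norm x0) h.
have e1 : expR x <= 1 by rewrite -[X in _ <= X]expR0 ler_expR ltW.
rewrite [X in X <= _]ler0_norm ?subr_le0 // (ltr0_norm x0).
have := expR_ge1Dx x; have : 1 <= expR (- x) by rewrite -[X in X <= _]expR0 ler_expR; lra.
by nra.
Qed.

Lemma expR_sub1x_bound x : `|expR x - 1 - x| <= x ^+ 2 * expR `|x|.
Proof.
have h0 : 0 <= expR x - 1 - x by have := expR_ge1Dx x; lra.
rewrite ger0_norm //.
have h : expR x - 1 <= x * expR x.
  have := expR_ge1Dx (- x); rewrite expRN => h.
  have e0 := expR_gt0 x.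
  have : (1 - x) * expR x <= 1 by rewrite -ler_pdivlMr // mul1r.
  by lra.
have h1 : expR x - 1 - x <= x * (expR x - 1) by lra.
apply: (le_trans h1); apply: (le_trans (ler_norm _)); rewrite normrM.
rewrite -(real_normK (num_real x)) expr2 -mulrA ler_wpM2l //.
exact: expR_sub1_bound.
Qed.

(** Real and imaginary parts contribute [2 * (r ^+ 2 * expR r)] each. This is the Taylor estimate
    behind [gauss_rem_dom]. *)
Lemma cexp_taylor2 z : cabs (cexp z - 1 - z) <= 4 * cabs z ^+ 2 * expR (cabs z).
Proof.
apply: (le_trans (cabs_le_ReIm _)); case: z => x y /=.
set r := cabs _.
have hx : `|x| <= r by exact: (le_Re_cabs (Complex x y)).
have hy : `|y| <= r by exact: (le_Im_cabs (Complex x y)).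
have r0 : 0 <= r by exact: cabs_ge0.
have ex : expR `|x| <= expR r by rewrite ler_expR.
have exx : expR x <= expR `|x| by rewrite ler_expR ler_norm.
have e0 := expR_gt0 x.
have x2 : x ^+ 2 <= r ^+ 2 by rewrite -(real_normK (num_real x)) ler_pXn2r ?nnegrE.
have y2 : y ^+ 2 <= r ^+ 2 by rewrite -(real_normK (num_real y)) ler_pXn2r ?nnegrE.
have er0 := expR_gt0 r.
have A : `|expR x * cos y - 1 - x| <= 2 * (r ^+ 2 * expR r).
  rewrite (_ : _ - _ = (expR x - 1 - x) + expR x * (cos y - 1)); last by ring.
  apply: (le_trans (ler_normD _ _)); rewrite mulr_natl mulr2n lerD //.
    apply: (le_trans (expR_sub1x_bound x)).
    by apply: ler_pM => //; rewrite ?sqr_ge0 // expR_ge0.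
  rewrite normrM (gtr0_norm e0) mulrC ler_pM ?normr_ge0 ?(ltW e0) //; last by lra.
  by apply: (le_trans (cos_sub1_bound y)); have := sqr_ge0 y; lra.
have B : `|expR x * sin y - 0 - y| <= 2 * (r ^+ 2 * expR r).
  rewrite (_ : _ - _ = expR x * (sin y - y) + (expR x - 1) * y); last by ring.
  apply: (le_trans (ler_normD _ _)); rewrite mulr_natl mulr2n lerD //.
    rewrite normrM (gtr0_norm e0) mulrC ler_pM ?normr_ge0 ?(ltW e0) //; last by lra.
    by apply: (le_trans (sin_sub_bound y)).
  rewrite normrM expr2 [X in _ <= X]mulrAC ler_pM //.
  apply: (le_trans (expR_sub1_bound x)); apply: ler_pM => //; exact: expR_ge0.
by move: A B; rewrite subr0; lra.
Qed.

End ComplexExp.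

(** * Bilateral series *)

Section IntSum.
Variable R : realType.
Implicit Types (f g : int -> R[i]) (K : R) (n : int).

Definition zpart f (N : nat) : R[i] := \sum_(k < (2 * N).+1) f (k%:Z - N%:Z).

(** Built exactly like [theta0], so that [theta0E] holds by conversion. Convergence of the partial
    sums is supplied by [zdecay]. *)
Definition zsum f : R[i] :=
  Complex (limn (fun N => Re (zpart f N))) (limn (fun N => Im (zpart f N))).

(** Geometric decay of fixed ratio stands for absolute convergence: every truncation error takes the
    form [D * 2^-1 ^+ N]. *)
Definition zdecay f K := forall n, cabs (f n) <= K * 2^-1 ^+ `|n|%N.

Lemma zdecay_ge0 f K : zdecay f K -> 0 <= K.
Proof. by move=> /(_ 0); rewrite expr0 mulr1; apply: le_trans; exact: cabs_ge0. Qed.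

Lemma zpart0 f : zpart f 0 = f 0.
Proof. by rewrite /zpart big_ord_recl big_ord0 addr0. Qed.

Lemma zpartS f N : zpart f N.+1 = zpart f N + (f N.+1%:Z + f (- N.+1%:Z)).
Proof.
rewrite /zpart mulnS add2n big_ord_recl big_ord_recr /=.
rewrite [LHS]addrC -[LHS]addrA; congr (_ + (_ + _)).
- by apply: eq_bigr => i _; congr f; rewrite /bump /=; lia.
- by congr f; rewrite /bump /=; lia.
by congr f; lia.
Qed.

Lemma zpart_cauchy f K N m : zdecay f K ->
  cabs (zpart f (N + m) - zpart f N) <= 2 * K * (2^-1 ^+ N - 2^-1 ^+ (N + m)).
Proof.
move=> fK; elim: m => [|m IH]; first by rewrite addn0 !subrr cabs0 mulr0.
rewrite addnS zpartS addrAC; apply: (le_trans (cabsD _ _)).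
have h1 : cabs (f (N + m).+1%:Z + f (- (N + m).+1%:Z)) <= 2 * (K * 2^-1 ^+ (N + m).+1).
  apply: (le_trans (cabsD _ _)); rewrite mulr_natl mulr2n; apply: lerD.
    exact: (fK (N + m).+1%:Z).
  by have := fK (- (N + m).+1%:Z); rewrite abszN.
apply: (le_trans (lerD IH h1)).
by rewrite exprS; lra.
Qed.

Lemma half_expn_lt (D eps : R) : 0 < eps -> exists N : nat, forall M, (N <= M)%N -> D * 2^-1 ^+ M < eps.
Proof.
move=> e0; exists (Num.bound `|D / eps|) => M hM.
have h : D / eps < (2 ^ M)%:R.
  apply: (le_lt_trans (ler_norm _)); apply: (lt_trans (archi_boundP (normr_ge0 _))).
  by rewrite ltr_nat (leq_ltn_trans hM) // ltn_expl.
by rewrite exprVn ltr_pdivrMr ?exprn_gt0 // -natrX mulrC -ltr_pdivrMr.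
Qed.

Lemma geometric_cauchy_lim (u : nat -> R) D :
  (forall N m, `|u (N + m)%N - u N| <= D * 2^-1 ^+ N) ->
  forall N, `|limn u - u N| <= D * 2^-1 ^+ N.
Proof.
move=> h; have cu : cvgn u.
  apply: cauchy_cvg; apply: cauchy_exP => e e0.
  have [N hN] := half_expn_lt D e0; exists (u N); exists N => // M /= hM.
  by rewrite /ball /= distrC -(subnKC hM); apply: (le_lt_trans (h _ _)); exact: hN.
move=> N; rewrite ler_norml; apply/andP; split.
  rewrite lerBrDr; apply: limr_ge => //; exists N => // M /= hM.
  by have := h N (M - N)%N; rewrite subnKC // ler_norml => /andP[]; lra.
rewrite lerBlDr; apply: limr_le => //; exists N => // M /= hM.
by have := h N (M - N)%N; rewrite subnKC // ler_norml => /andP[]; lra.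
Qed.

Lemma zsum_error f K N : zdecay f K -> cabs (zsum f - zpart f N) <= 4 * K * 2^-1 ^+ N.
Proof.
move=> fK; have K0 := zdecay_ge0 fK.
have h M m : cabs (zpart f (M + m) - zpart f M) <= 2 * K * 2^-1 ^+ M.
  apply: (le_trans (zpart_cauchy M m fK)); rewrite ler_wpM2l ?mulr_ge0 //.
  by rewrite gerBl exprn_ge0 // invr_ge0.
apply: (le_trans (cabs_le_ReIm _)).
rewrite (_ : 4 * K * _ = 2 * K * 2^-1 ^+ N + 2 * K * 2^-1 ^+ N); last by ring.
apply: lerD.
  rewrite raddfB /=.
  apply: (@geometric_cauchy_lim (fun N => Re (zpart f N))) => M m.
  by apply: le_trans (h M m); rewrite -raddfB; exact: le_Re_cabs.
rewrite raddfB /=.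
apply: (@geometric_cauchy_lim (fun N => Im (zpart f N))) => M m.
by apply: le_trans (h M m); rewrite -raddfB; exact: le_Im_cabs.
Qed.

(** The common tool for linearity, shift and reflection: each is checked on partial sums, up to a
    geometrically small error. *)
Lemma zsum_unique f K S D : zdecay f K ->
  (forall N, cabs (zpart f N - S) <= D * 2^-1 ^+ N) -> zsum f = S.
Proof.
move=> fK h; apply/eqP; rewrite -subr_eq0; apply/eqP/cabs_eq0/le_anti.
rewrite cabs_ge0 andbT; apply/ler_addgt0Pl => e e0; rewrite addr0.
have [N hN] := half_expn_lt (4 * K + D) e0.
apply: le_trans (ltW (hN N (leqnn N))); rewrite mulrDl.
rewrite (_ : zsum f - S = (zsum f - zpart f N) + (zpart f N - S)); last by ring.
by apply: (le_trans (cabsD _ _)); rewrite lerD // zsum_error.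
Qed.

Lemma cabs_zsum f K : zdecay f K -> cabs (zsum f) <= 5 * K.
Proof.
move=> fK; have := zsum_error 0 fK; rewrite zpart0 expr0 mulr1 => h.
have h0 := fK 0; rewrite expr0 mulr1 in h0.
rewrite (_ : zsum f = (zsum f - f 0) + f 0); last by ring.
by apply: (le_trans (cabsD _ _)); lra.
Qed.

Lemma eq_zsum f g : f =1 g -> zsum f = zsum g.
Proof. by move=> /funext ->. Qed.

Lemma zdecayD f g K L : zdecay f K -> zdecay g L -> zdecay (fun n => f n + g n) (K + L).
Proof.
move=> fK gL n; apply: (le_trans (cabsD _ _)).
by rewrite mulrDl lerD ?fK ?gL.
Qed.

Lemma zdecayZ c f K : zdecay f K -> zdecay (fun n => c * f n) (cabs c * K).
Proof. by move=> fK n; rewrite cabsM -mulrA ler_wpM2l ?cabs_ge0 ?fK. Qed.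

Lemma zsumD f g K L : zdecay f K -> zdecay g L ->
  zsum (fun n => f n + g n) = zsum f + zsum g.
Proof.
move=> fK gL; apply: (zsum_unique (D := 4 * K + 4 * L) (zdecayD fK gL)) => N.
rewrite /zpart big_split /= -!/(zpart _ _) -opprB cabsN.
rewrite (_ : zsum f + zsum g - _ = (zsum f - zpart f N) + (zsum g - zpart g N)); last by ring.
apply: (le_trans (cabsD _ _)); rewrite mulrDl lerD //; exact: zsum_error.
Qed.

Lemma zsumZ c f K : zdecay f K -> zsum (fun n => c * f n) = c * zsum f.
Proof.
move=> fK; apply: (zsum_unique (D := cabs c * (4 * K)) (zdecayZ c fK)) => N.
rewrite /zpart -big_distrr /= -!/(zpart _ _) -mulrBr cabsM -mulrA ler_wpM2l ?cabs_ge0 //.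
by rewrite -opprB cabsN zsum_error.
Qed.

Lemma zsumB f g K L : zdecay f K -> zdecay g L ->
  zsum (fun n => f n - g n) = zsum f - zsum g.
Proof.
move=> fK gL.
rewrite -mulN1r -(zsumZ (-1) gL) -(zsumD fK (zdecayZ (-1) gL)).
by apply: eq_zsum => n; rewrite mulN1r.
Qed.

Lemma zdecay_shift f K : zdecay f K -> zdecay (fun n => f (n + 1)) (2 * K).
Proof.
move=> fK n; apply: (le_trans (fK _)).
rewrite -mulrA mulrCA ler_wpM2l ?(zdecay_ge0 fK) //.
have h : leq (absz n) (absz (n + 1)).+1 by lia.
have h2 : 2^-1 ^+ (absz (n + 1)).+1 <= (2^-1 : R) ^+ `|n|%N by apply: ler_wiXn2l => //; lra.
by move: h2; rewrite exprS; lra.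
Qed.

Lemma zsum_shift f K : zdecay f K -> zsum (fun n => f (n + 1)) = zsum f.
Proof.
move=> fK; have K0 := zdecay_ge0 fK.
apply: (zsum_unique (D := 6 * K) (zdecay_shift fK)) => N.
(* The shifted partial sum differs by two boundary terms only; they add [2 * K] to the [4 * K] of
   [zsum_error]. *)
have E : zpart (fun n => f (n + 1)) N = zpart f N + (f (N%:Z + 1) - f (- N%:Z)).
  rewrite /zpart big_ord_recr [X in _ = X + _]big_ord_recl /=.
  rewrite (_ : (2 * N)%:Z - N%:Z + 1 = N%:Z + 1); last by lia.
  rewrite (_ : 0 - N%:Z = - N%:Z); last by lia.
  rewrite [RHS]addrC -!addrA (addrC (- _)) -!addrA; 
  rewrite (_ : \sum_(i < 2 * N) f (i%:Z - N%:Z + 1) = \sum_(i < 2 * N) f ((lift ord0 i)%:Z - N%:Z)).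
    by ring.
  by apply: eq_bigr => i _; congr f; rewrite /= /bump; lia.
rewrite E addrAC; apply: (le_trans (cabsD _ _)).
have h1 := zsum_error N fK; rewrite -opprB cabsN in h1.
have h2 := fK (N%:Z + 1); have h3 := fK (- N%:Z).
have : cabs (f (N%:Z + 1) - f (- N%:Z)) <= 2 * (K * 2^-1 ^+ N).
  apply: (le_trans (cabsB _ _)); rewrite mulr_natl mulr2n lerD //; last first.
    by move: h3; rewrite abszN.
  apply: (le_trans h2); rewrite ler_wpM2l //.
  rewrite (_ : absz (N%:Z + 1) = N.+1); last by lia.
  rewrite exprS ler_piMl ?exprn_ge0 ?invr_ge0 //; lra.
by lra.
Qed.

Lemma zsum_opp f K : zdecay f K -> zsum (fun n => f (- n)) = zsum f.
Proof.
move=> fK.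
have fK' : zdecay (fun n => f (- n)) K by move=> n; rewrite -(abszN n); exact: fK.
apply: (zsum_unique (D := 4 * K) fK') => N.
have -> : zpart (fun n => f (- n)) N = zpart f N.
  rewrite /zpart (reindex_inj rev_ord_inj) /=; apply: eq_bigr => i _; congr f.
  by have := ltn_ord i; lia.
by rewrite -opprB cabsN zsum_error.
Qed.

End IntSum.

(** * Averages over finer and finer lattices *)

Section Averages.
Variable R : realType.
Implicit Types (f g V : R -> R[i]) (K x t : R) (N : nat).

(** The rate suits both uses: since e <= 4 a shift by at most 1 costs a factor 4, and since e >= 2
    the values at integers satisfy [zdecay]. *)
Definition rdecay f K := forall x, cabs (f x) <= K * expR (- `|x|).

(** The Riemann sum of step 1/N over the whole line, its nodes grouped by their fractional part
    j/N. *)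
Definition avg N f : R[i] :=
  (N%:R^-1)%:C * \sum_(j < N) zsum (fun n => f (n%:~R + j%:R / N%:R)).

Lemma expR1_le4 : expR (1 : R) <= 4.
Proof.
have h := expR_ge1Dx (- (1 / 2) : R); rewrite expRN in h.
have e0 := expR_gt0 (1 / 2 : R).
have h2 : expR (1 / 2 : R) <= 2.
  have : (2^-1 : R) <= (expR (1 / 2))^-1 by lra.
  by rewrite lef_pV2 ?posrE.
rewrite [1](splitr 1) expRD; nra.
Qed.

Lemma expR1_ge2 : 2 <= expR (1 : R).
Proof. by have := expR_ge1Dx (1 : R); lra. Qed.

Lemma rdecay_ge0 f K : rdecay f K -> 0 <= K.
Proof.
move=> /(_ 0) h; have : 0 <= K * expR (- `|0 : R|) := le_trans (cabs_ge0 _) h.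
by rewrite normr0 oppr0 expR0 mulr1.
Qed.

Lemma expR_norm_shift x t : 0 <= t <= 1 -> expR (- `|x + t|) <= 4 * expR (- `|x|).
Proof.
move=> /andP[t0 t1].
have h : - `|x + t| <= 1 + - `|x|.
  have := ler_normB (x + t) t; rewrite addrK (ger0_norm t0); lra.
apply: (@le_trans _ _ (expR (1 + - `|x|))); first by rewrite ler_expR.
by rewrite expRD ler_wpM2r ?expR_ge0 // expR1_le4.
Qed.

Lemma expR_norm_int (n : int) : expR (- `|n%:~R : R|) <= 2^-1 ^+ `|n|%N.
Proof.
have -> : `|n%:~R : R| = `|n|%N%:R by rewrite -intr_norm -abszE -pmulrn.
rewrite expRN -[X in expR X]mul1r expRM_natr exprVn lef_pV2 ?posrE ?exprn_gt0 ?expR_gt0 //.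
by apply: lerXn2r; rewrite ?nnegrE ?expR_ge0 ?expR1_ge2.
Qed.

Lemma rdecay_shift f K t : rdecay f K -> 0 <= t <= 1 -> rdecay (fun x => f (x + t)) (4 * K).
Proof.
move=> fK ht x; apply: (le_trans (fK _)); rewrite -mulrA mulrCA ler_wpM2l ?(rdecay_ge0 fK) //.
exact: expR_norm_shift.
Qed.

Lemma zdecay_rdecay f K t : rdecay f K -> 0 <= t <= 1 ->
  zdecay (fun n => f (n%:~R + t)) (4 * K).
Proof.
move=> fK ht n; apply: (le_trans (rdecay_shift fK ht n%:~R)).
by rewrite ler_wpM2l ?expR_norm_int // mulr_ge0 // (rdecay_ge0 fK).
Qed.

Lemma ord_frac_itv N (j : 'I_N) : 0 <= (j%:R : R) / N%:R <= 1.
Proof.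
have N0 : (0 < N)%N by apply: leq_ltn_trans (ltn_ord j).
by rewrite divr_ge0 //= ler_pdivrMr ?ltr0n // mul1r ler_nat ltnW.
Qed.

Lemma avg_bound N f K : rdecay f K -> cabs (avg N f) <= 20 * K.
Proof.
move=> fK; rewrite /avg cabsM cabs_real ger0_norm ?invr_ge0 //.
have K0 := rdecay_ge0 fK.
have h : cabs (\sum_(j < N) zsum (fun n => f (n%:~R + j%:R / N%:R))) <= N%:R * (20 * K).
  apply: (le_trans (cabs_sum _ _ _)).
  apply: (@le_trans _ _ (\sum_(j < N) (20 * K))); last by rewrite sumr_const card_ord (mulr_natl (20 * K)).
  apply: ler_sum => j _.
  by have := cabs_zsum (zdecay_rdecay fK (ord_frac_itv j)); lra.
case: N h => [|N] h; first by rewrite invr0 mul0r mulr_ge0.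
by rewrite -ler_pdivlMl ?invr_gt0 ?ltr0n // invrK.
Qed.

(** Moving by one node sends class [j] to class [j + 1], and the last class to class 0 with [n]
    increased by 1. This exact invariance plays the part of the vanishing of the integral of a
    derivative. *)
Lemma avg_shift N f K : rdecay f K -> avg N (fun x => f (x + N%:R^-1)) = avg N f.
Proof.
move=> fK; rewrite /avg; congr (_ * _); case: N => [|N]; first by rewrite !big_ord0.
have N0 : (N.+1%:R : R) != 0 by rewrite pnatr_eq0.
rewrite big_ord_recr [RHS]big_ord_recl /= addrC; congr (_ + _).
  rewrite mul0r -(zsum_shift (zdecay_rdecay fK (_ : 0 <= 0 <= 1))) ?lexx ?ler01 //.
  apply: eq_zsum => n; congr f; rewrite intrD addr0 -addrA; congr (_ + _).
  by field; rewrite -natr1 in N0.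
apply: eq_bigr => j _; apply: eq_zsum => n; congr f.
by rewrite -addrA; congr (_ + _); rewrite /bump /= add1n -[in RHS]natr1 mulrDl mul1r.
Qed.

Lemma avgZ N f c K : rdecay f K -> avg N (fun x => c * f x) = c * avg N f.
Proof.
move=> fK; rewrite /avg mulrCA; congr (_ * _); rewrite big_distrr /=.
by apply: eq_bigr => j _; rewrite (zsumZ _ (zdecay_rdecay fK (ord_frac_itv j))).
Qed.

Lemma avgB N f g K L : rdecay f K -> rdecay g L ->
  avg N (fun x => f x - g x) = avg N f - avg N g.
Proof.
move=> fK gL; rewrite /avg -mulrBr -sumrB; congr (_ * _).
apply: eq_bigr => j _.
by rewrite (zsumB (zdecay_rdecay fK (ord_frac_itv j)) (zdecay_rdecay gL (ord_frac_itv j))).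
Qed.

Lemma rdecayB f g K L : rdecay f K -> rdecay g L -> rdecay (fun x => f x - g x) (K + L).
Proof. by move=> fK gL x; apply: (le_trans (cabsB _ _)); rewrite mulrDl lerD ?fK ?gL. Qed.

(* The averages of [V (x + 1/N)] and of [V x] agree, so only the second-order error survives. *)
Lemma avg_step N f g V K L M E : (0 < N)%N -> rdecay f K -> rdecay g L -> rdecay V M ->
  rdecay (fun x => g x - f x - (V (x + N%:R^-1) - V x)) E ->
  cabs (avg N g - avg N f) <= 20 * E.
Proof.
move=> N0 fK gL VM h.
have N1 : 0 <= (N%:R^-1 : R) <= 1 by rewrite invr_ge0 ler0n /= invf_le1 ?ltr0n // ler1n.
have VM' := rdecay_shift VM N1.
have := avg_bound N h.
by rewrite (avgB N (rdecayB gL fK) (rdecayB VM' VM)) (avgB N gL fK) (avgB N VM' VM)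
  (avg_shift N VM) subrr subr0.
Qed.

End Averages.

(** * Gaussians on complex lines: uniform decay and Taylor remainders *)

Section Gaussian.
Variable R : realType.
Implicit Types (x u t d B c : R) (z y lam s : R[i]).

Definition gauss z : R[i] := cexp (- (pi%:C * z ^+ 2)).

(** For [0 < d] the first condition gives Re lam^2 = (Re lam - |Im lam|)(Re lam + |Im lam|) >= d^2,
    hence Gaussian decay with constants depending on [d] and [B] only; in this form the set is
    convex. *)
Definition sector d B lam s :=
  [/\ d <= Re lam - `|Im lam|, cabs lam <= B & cabs s <= B].

Lemma pi_le4 : pi <= 4 :> R.
Proof. by have := @pihalf_lt2 R; lra. Qed.

Lemma cabs_gauss z : cabs (gauss z) = expR (- (pi * Re (z ^+ 2))).
Proof. by rewrite /gauss cabs_cexp raddfN /=; case: (z ^+ 2) => a b /=; rewrite mul0r subr0. Qed.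

Lemma sector_cabs_arg d B lam s x : sector d B lam s ->
  cabs (lam * x%:C + s) <= B * (`|x| + 1).
Proof.
case=> _ hl hs; apply: (le_trans (cabsD _ _)); rewrite cabsM cabs_real mulrDr mulr1 lerD //.
by rewrite ler_wpM2r.
Qed.

Lemma Re_sqr_ge d B lam s x : 0 < d -> sector d B lam s ->
  d ^+ 2 * x ^+ 2 - 2 * B ^+ 2 * `|x| - B ^+ 2 <= Re ((lam * x%:C + s) ^+ 2).
Proof.
move=> d0 [h1 h2 h3].
have B0 : 0 <= B := le_trans (cabs_ge0 _) h2.
have Reh z : Re z >= - cabs z.
  by have := le_Re_cabs z; rewrite ler_norml => /andP[].
have -> : (lam * x%:C + s) ^+ 2 = (x ^+ 2)%:C * lam ^+ 2 + (lam * s * (2 * x)%:C + s * s).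
  by rewrite rmorphXn /= rmorphM /= rmorph_nat; ring.
rewrite raddfD /=.
have k1 : d ^+ 2 * x ^+ 2 <= Re ((x ^+ 2)%:C * lam ^+ 2).
  have -> : Re ((x ^+ 2)%:C * lam ^+ 2) = x ^+ 2 * (Re lam ^+ 2 - Im lam ^+ 2).
    by case: (lam) => p q /=; ring.
  rewrite mulrC ler_wpM2l ?sqr_ge0 // -(real_normK (num_real (Im lam))).
  by have := normr_ge0 (Im lam); nra.
have k2 : - (2 * B ^+ 2 * `|x|) - B ^+ 2 <= Re (lam * s * (2 * x)%:C + s * s).
  apply: le_trans (Reh _); rewrite -opprD lerN2; apply: (le_trans (cabsD _ _)); apply: lerD.
    rewrite !cabsM cabs_real normrM (ger0_norm (_ : 0 <= 2)) // mulrA ler_wpM2r //.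
    by rewrite [X in X <= _]mulrC ler_wpM2l // expr2 ler_pM ?cabs_ge0.
  by rewrite cabsM expr2 ler_pM ?cabs_ge0.
by lra.
Qed.

(** As pi >= 2, the Gaussian provides two factors e^(-d^2 x^2): one pays for the growth on the left,
    the other dominates all linear terms, by completing the square. The quadratic growth is allowed
    because the remainder in [gauss_rem_dom] produces it. *)
Lemma gauss_dom d B c : 0 < d -> exists2 K, 0 <= K & forall lam s x, sector d B lam s ->
  cabs (gauss (lam * x%:C + s)) * expR (d ^+ 2 * x ^+ 2 + c * (`|x| + 1)) <= K * expR (- `|x|).
Proof.
move=> d0; pose b := 8 * B ^+ 2 + `|c|.
have b0 : 0 <= b by rewrite addr_ge0 // mulr_ge0 // sqr_ge0.
exists (expR ((b + 1) ^+ 2 / (4 * d ^+ 2) + b)); first exact: expR_ge0.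
move=> lam s x hs; rewrite cabs_gauss -!expRD ler_expR.
have := Re_sqr_ge x d0 hs; set S := Re _ => hS.
have p2 := pi_ge2 R; have p4 := pi_le4.
have B2 := sqr_ge0 B.
have t0 := normr_ge0 x; have c1 := ler_norm c.
have xx : x ^+ 2 = `|x| ^+ 2 by rewrite real_normK ?num_real.
rewrite xx in hS *; set t := `|x| in t0 hS *.
have h1 : - (pi * S) <= - (2 * (d ^+ 2 * t ^+ 2)) + 8 * B ^+ 2 * (t + 1).
  have h : pi * (d ^+ 2 * t ^+ 2 - 2 * B ^+ 2 * t - B ^+ 2) <= pi * S by rewrite ler_wpM2l // pi_ge0.
  have hd : 2 * (d ^+ 2 * t ^+ 2) <= pi * (d ^+ 2 * t ^+ 2) by rewrite ler_wpM2r // mulr_ge0 ?sqr_ge0.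
  have hm : 0 <= B ^+ 2 * t by rewrite mulr_ge0.
  have he : pi * (2 * B ^+ 2 * t + B ^+ 2) <= 4 * (2 * B ^+ 2 * t + B ^+ 2).
    by rewrite ler_wpM2r //; lra.
  by lra.
have h2 : c * (t + 1) <= `|c| * (t + 1) by rewrite ler_wpM2r //; lra.
have h3 : (b + 1) * t <= d ^+ 2 * t ^+ 2 + (b + 1) ^+ 2 / (4 * d ^+ 2).
  rewrite -subr_ge0 (_ : _ - _ = (d * t - (b + 1) / (2 * d)) ^+ 2); first exact: sqr_ge0.
  by field; rewrite gt_eqF.
by rewrite /b in h3 *; lra.
Qed.

Definition gauss_rem z y := gauss (z + y) - gauss z + (2 * pi)%:C * z * y * gauss z.

Lemma gauss_remE z y : let e := - ((2 * pi)%:C * z * y + pi%:C * y ^+ 2) in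
  gauss_rem z y = gauss z * ((cexp e - 1 - e) - pi%:C * y ^+ 2).
Proof.
rewrite /= /gauss_rem {1}/gauss.
rewrite (_ : - (pi%:C * (z + y) ^+ 2) =
  - (pi%:C * z ^+ 2) + - ((2 * pi)%:C * z * y + pi%:C * y ^+ 2)); last first.
  by rewrite !rmorphM /= rmorph_nat; ring.
by rewrite cexpD -/(gauss z); ring.
Qed.

Lemma expr_le_expR t n : 0 <= t -> t ^+ n <= expR (n%:R * t).
Proof.
move=> t0; rewrite mulrC expRM_natr lerXn2r ?nnegrE ?expR_ge0 //.
by have := expR_ge1Dx t; lra.
Qed.

Lemma gauss_poly_dom d B : 0 < d -> exists2 K, 0 <= K & forall lam s x, sector d B lam s ->
  cabs (gauss (lam * x%:C + s)) * (`|x| + 1) ^+ 2 <= K * expR (- `|x|).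
Proof.
move=> d0; have [K K0 hK] := gauss_dom B 2 d0; exists K => // lam s x hs.
apply: le_trans (hK lam s x hs); rewrite ler_wpM2l ?cabs_ge0 //.
apply: (le_trans (expr_le_expR _ _)); first by rewrite addr_ge0.
by rewrite ler_expR lerDr mulr_ge0 ?sqr_ge0.
Qed.

(** By [gauss_remE] the remainder is the Gaussian times a second-order remainder of [cexp]. The
    extra factor [|x| + 1] is there for the linear factor of [primitive]. *)
Lemma gauss_rem_dom d B : 0 < d -> 1 <= B ->
  exists K u0, [/\ 0 <= K, 0 < u0 & forall lam s x u y, sector d B lam s ->
    0 <= u <= u0 -> cabs y <= B * (`|x| + 1) * u ->
    cabs (gauss_rem (lam * x%:C + s) y) * (`|x| + 1) <= K * u ^+ 2 * expR (- `|x|)].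
Proof.
(* 5 counts powers of [|x| + 1]: four from the squared exponent, one from the statement. *)
move=> d0 B1; have [K K0 hK] := gauss_dom B 5 d0.
(* 12 = 8 + 4, from pi <= 4 in 2 pi |z| |y| + pi |y|^2. *)
pose A := 12 * B ^+ 2.
have A0 : 0 < A by rewrite mulr_gt0 // exprn_gt0 //; lra.
(* The threshold on [u] keeps the exponent below [d ^+ 2 * x ^+ 2 + d ^+ 2], the growth that
   [gauss_dom] absorbs. *)
exists ((4 * A ^+ 2 + 4 * B ^+ 2) * expR (d ^+ 2) * K), (Num.min 1 (d ^+ 2 / (2 * A))).
split.
- by rewrite !mulr_ge0 ?expR_ge0 // addr_ge0 // mulr_ge0 // sqr_ge0.
- by rewrite lt_min ltr01 /= divr_gt0 ?exprn_gt0 // mulr_gt0.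
move=> lam s x u y hs /andP[u0]; rewrite le_min => /andP[u1 ud] hy.
have hz := sector_cabs_arg x hs.
have := hK lam s x hs; rewrite gauss_remE cabsM; set z := _ * _ + s in hz *.
set e := - (_ + _); set g := cabs (gauss z); set X := `|x| + 1 in hz hy * => hg.
have X1 : 1 <= X by rewrite /X lerDr.
have g0 : 0 <= g by exact: cabs_ge0.
have p4 := pi_le4; have p0 := pi_ge0 R.
have he : cabs e <= A * X ^+ 2 * u.
  rewrite cabsN; apply: (le_trans (cabsD _ _)).
  rewrite (expr2 y) !cabsM !cabs_real (ger0_norm p0) ger0_norm ?mulr_ge0 //.
  have hzy : cabs z * cabs y <= (B * X) * (B * X * u) by apply: ler_pM; rewrite ?cabs_ge0.
  have hyy : cabs y * cabs y <= (B * X * u) * (B * X * u) by apply: ler_pM; rewrite ?cabs_ge0.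
  have m1 : 2 * pi * cabs z * cabs y <= 8 * ((B * X) * (B * X * u)).
    by rewrite -mulrA ler_pM ?mulr_ge0 ?cabs_ge0 //; lra.
  have m2 : pi * (cabs y * cabs y) <= 4 * ((B * X * u) * (B * X * u)).
    by rewrite ler_pM ?mulr_ge0 ?cabs_ge0.
  have m3 : (B * X * u) * (B * X * u) <= (B * X) * (B * X * u).
    have BX : 0 <= B * X by rewrite mulr_ge0 //; lra.
    have Pu : B * X * u <= B * X by rewrite ler_piMr.
    by apply: ler_wpM2r Pu; rewrite mulr_ge0.
  by rewrite /A; lra.
have he2 : cabs e <= d ^+ 2 * x ^+ 2 + d ^+ 2.
  apply: (le_trans he); have XX : X ^+ 2 <= 2 * (x ^+ 2 + 1).
    by rewrite /X -(real_normK (num_real x)); have := sqr_ge0 (`|x| - 1); lra.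
  apply: (@le_trans _ _ (A * (2 * (x ^+ 2 + 1)) * u)).
    by rewrite ler_wpM2r // ler_wpM2l // ltW.
  have : u * (2 * A) <= d ^+ 2 by rewrite -ler_pdivlMr // mulr_gt0.
  by have := sqr_ge0 x; nra.
have X0 : 0 <= X by lra.
have hrem : cabs (cexp e - 1 - e - pi%:C * y ^+ 2) <=
    u ^+ 2 * ((4 * A ^+ 2 + 4 * B ^+ 2) * X ^+ 4 * expR (d ^+ 2 * x ^+ 2 + d ^+ 2)).
  set Ex := expR (_ + _).
  have Ex1 : 1 <= Ex by rewrite /Ex -[X in X <= _]expR0 ler_expR; have := sqr_ge0 x; have := sqr_ge0 d; nra.
  apply: (le_trans (cabsB _ _)).
  have r1 : cabs (cexp e - 1 - e) <= 4 * (A * X ^+ 2 * u) ^+ 2 * Ex.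
    have q1 : cabs e ^+ 2 <= (A * X ^+ 2 * u) ^+ 2.
      by rewrite lerXn2r ?nnegrE ?cabs_ge0 // (le_trans (cabs_ge0 _) he).
    have q2 : expR (cabs e) <= Ex by rewrite ler_expR.
    apply: (le_trans (cexp_taylor2 e)); apply: ler_pM => //.
    - by rewrite mulr_ge0 ?sqr_ge0.
    - by rewrite ler_wpM2l.
  have r2 : cabs (pi%:C * y ^+ 2) <= 4 * (B * X * u) ^+ 2 * Ex.
    rewrite cabsM cabs_real (ger0_norm p0) !expr2 cabsM -[X in X <= _]mulr1.
    apply: ler_pM => //; rewrite ?mulr_ge0 ?cabs_ge0 //.
    by apply: ler_pM; rewrite ?mulr_ge0 ?cabs_ge0 // ler_pM ?cabs_ge0.
  apply: (le_trans (lerD r1 r2)).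
  have X24 : X ^+ 2 <= X ^+ 4 by rewrite ler_weXn2l.
  have r3 : 4 * (B * X * u) ^+ 2 <= u ^+ 2 * (4 * B ^+ 2 * X ^+ 4).
    rewrite (_ : 4 * _ ^+ 2 = u ^+ 2 * (4 * B ^+ 2 * X ^+ 2)); last by ring.
    by rewrite ler_wpM2l ?sqr_ge0 // ler_wpM2l // mulr_ge0 // sqr_ge0.
  rewrite (_ : u ^+ 2 * _ =
    4 * (A * X ^+ 2 * u) ^+ 2 * Ex + u ^+ 2 * (4 * B ^+ 2 * X ^+ 4) * Ex); last by ring.
  by rewrite lerD2l ler_wpM2r ?expR_ge0.
rewrite mulrAC.
apply: (le_trans (ler_wpM2l (mulr_ge0 g0 X0) hrem)).
have h5 : X ^+ 5 <= expR (5 * X) by exact: expr_le_expR.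
have hfin : g * (X ^+ 5 * expR (d ^+ 2 * x ^+ 2)) <= K * expR (- `|x|).
  apply: le_trans hg; rewrite ler_wpM2l // expRD mulrC ler_wpM2l ?expR_ge0 //.
rewrite expRD; set e1 := expR (d ^+ 2 * x ^+ 2) in hfin *; set e2 := expR (d ^+ 2).
set Q := 4 * A ^+ 2 + _; set ex := expR (- _) in hfin *.
rewrite (_ : g * X * _ = (Q * e2 * u ^+ 2) * (g * (X ^+ 5 * e1))); last by ring.
rewrite (_ : Q * e2 * K * _ * ex = (Q * e2 * u ^+ 2) * (K * ex)); last by ring.
rewrite ler_wpM2l // mulr_ge0 ?sqr_ge0 // mulr_ge0 ?expR_ge0 //.
by rewrite addr_ge0 // mulr_ge0 // sqr_ge0.
Qed.

End Gaussian.

(** * Changing the line of integration *)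

Section Contour.
Variable R : realType.
Implicit Types (x u t d B c : R) (z y lam s : R[i]).

(** The pull-back of the form e^(-pi z^2) dz to the line z = lam x + s. *)
Definition dilate lam s x : R[i] := lam * gauss (lam * x%:C + s).

(** Its derivative in x, h1 g + lam (h1 x + h2) g' with g and g' taken at lam x + s, is also the
    derivative of [dilate] in the direction (h1, h2): an infinitesimal Cauchy theorem. *)
Definition primitive lam s (h1 h2 : R[i]) x : R[i] := (h1 * x%:C + h2) * gauss (lam * x%:C + s).

Lemma gauss_rdecay d B : 0 < d -> exists2 K, 0 <= K & forall lam s, sector d B lam s ->
  rdecay (fun x => gauss (lam * x%:C + s)) K.
Proof.
move=> d0; have [K K0 hK] := gauss_poly_dom B d0; exists K => // lam s hs x.
apply: le_trans (hK lam s x hs); rewrite ler_peMr ?cabs_ge0 //.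
by have := normr_ge0 x; nra.
Qed.

Lemma primitive_rdecay d B : 0 < d -> exists2 K, 0 <= K & forall lam s (h1 h2 : R[i]),
  sector d B lam s -> cabs h1 <= B -> cabs h2 <= B -> rdecay (primitive lam s h1 h2) K.
Proof.
move=> d0; have [K K0 hK] := gauss_poly_dom B d0; exists (`|B| * K); first by rewrite mulr_ge0.
move=> lam s h1 h2 hs hh1 hh2 x; rewrite /primitive cabsM mulrC.
have B0 : 0 <= B := le_trans (cabs_ge0 _) hh1.
rewrite (ger0_norm B0) -mulrA.
apply: le_trans (ler_wpM2l B0 (hK lam s x hs)).
rewrite mulrCA ler_wpM2l ?cabs_ge0 //.
apply: (@le_trans _ _ (B * (`|x| + 1))).
  apply: (le_trans (cabsD _ _)); rewrite cabsM cabs_real mulrDr mulr1 lerD //.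
  by rewrite ler_wpM2r.
by rewrite ler_wpM2l //; have := normr_ge0 x; nra.
Qed.

(* The integral of [dilate lam s] does not depend on [lam] and [s]: to first order, moving
   [(lam, s)] by [(h1 u, h2 u)] has the same effect on it as adding
   [primitive (x + u) - primitive x]. *)
Lemma dilate_step d B : 0 < d -> 1 <= B ->
  exists K u0, [/\ 0 <= K, 0 < u0 & forall lam s (h1 h2 : R[i]) x u, sector d B lam s ->
    cabs h1 <= B -> cabs h2 <= B -> 0 <= u <= u0 ->
    cabs (dilate (lam + h1 * u%:C) (s + h2 * u%:C) x - dilate lam s x
      - (primitive lam s h1 h2 (x + u) - primitive lam s h1 h2 x))
      <= K * u ^+ 2 * expR (- `|x|)].
Proof.
move=> d0 B1.
have [K1 [u1 [K10 u10 hK1]]] := gauss_rem_dom d0 B1.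
have [K2 K20 hK2] := gauss_poly_dom B d0.
have B0 : 0 <= B by lra.
exists (4 * B * K1 + 16 * B ^+ 3 * K2), (Num.min 1 u1).
split.
- by rewrite addr_ge0 // !mulr_ge0 // exprn_ge0.
- by rewrite lt_min ltr01 u10.
move=> lam s h1 h2 x u hs hh1 hh2; rewrite le_min => /andP[u0 /andP[u1' uu1]].
set z := lam * x%:C + s; set g := h1 * x%:C + h2; set X := `|x| + 1.
have X1 : 1 <= X by rewrite /X lerDr.
have [_ hl _] := hs.
have hz : cabs z <= B * X by exact: sector_cabs_arg hs.
have hg : cabs g <= B * X.
  apply: (le_trans (cabsD _ _)); rewrite cabsM cabs_real mulrDr mulr1 lerD //.
  by rewrite ler_wpM2r.
have hR y : cabs y <= B * X * u -> cabs (gauss_rem z y) * X <= K1 * u ^+ 2 * expR (- `|x|).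
  by move=> hy; apply: hK1 => //; rewrite u0.
have hgu : cabs (g * u%:C) <= B * X * u by rewrite cabsM cabs_real ger0_norm // ler_wpM2r.
have hlu : cabs (lam * u%:C) <= B * X * u.
  rewrite cabsM cabs_real ger0_norm // ler_wpM2r //.
  by apply: (le_trans hl); rewrite ler_peMr.
have := hR _ hgu; have := hR _ hlu; have := hK2 lam s x hs; rewrite -/z -/X.
set r1 := gauss_rem z (g * u%:C); set r2 := gauss_rem z (lam * u%:C).
set w := u ^+ 2; set ex := expR _ => k2 k3 k4.
(* The first-order terms of [lam * r1] and [g * r2] cancel each other. The last summand is [h1 * u]
   times the difference of the Gaussians at [z + g * u] and [z + lam * u], again of second order. *)
have -> : dilate (lam + h1 * u%:C) (s + h2 * u%:C) x - dilate lam s x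
      - (primitive lam s h1 h2 (x + u) - primitive lam s h1 h2 x) =
    lam * r1 - g * r2 + h1 * u%:C *
      (r1 - r2 - (2 * pi)%:C * z * (g * u%:C - lam * u%:C) * gauss z).
  rewrite /dilate /primitive /r1 /r2 /gauss_rem.
  rewrite (_ : (lam + h1 * u%:C) * x%:C + (s + h2 * u%:C) = z + g * u%:C); last first.
    by rewrite /z /g; ring.
  rewrite (_ : lam * (x + u)%:C + s = z + lam * u%:C); last by rewrite /z rmorphD /=; ring.
  rewrite (_ : h1 * (x + u)%:C + h2 = g + h1 * u%:C); last by rewrite /g rmorphD /=; ring.
  by rewrite -/z -/g; ring.
have cr1 := cabs_ge0 r1; have cr2 := cabs_ge0 r2; have cg := cabs_ge0 (gauss z).
have w0 : 0 <= w by exact: sqr_ge0.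
have e0 : 0 <= ex by exact: expR_ge0.
have m1 : cabs r1 <= K1 * w * ex by apply: le_trans k4; rewrite ler_peMr.
have m2 : cabs r2 <= K1 * w * ex by apply: le_trans k3; rewrite ler_peMr.
have t1 : cabs (lam * r1) <= B * (K1 * w * ex) by rewrite cabsM ler_pM ?cabs_ge0.
have t2 : cabs (g * r2) <= B * (K1 * w * ex).
  rewrite cabsM; apply: (@le_trans _ _ (B * X * cabs r2)); first by rewrite ler_wpM2r.
  by rewrite -mulrA ler_wpM2l // mulrC.
have t3 : cabs (h1 * u%:C * (r1 - r2)) <= B * (2 * (K1 * w * ex)).
  rewrite !cabsM cabs_real ger0_norm //; apply: ler_pM; rewrite ?mulr_ge0 ?cabs_ge0 //.
    by rewrite -[B]mulr1; apply: ler_pM; rewrite ?cabs_ge0.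
  by apply: (le_trans (cabsB _ _)); lra.
have t4 : cabs (h1 * u%:C * ((2 * pi)%:C * z * (g * u%:C - lam * u%:C) * gauss z))
    <= 16 * B ^+ 3 * (w * (K2 * ex)).
  rewrite !cabsM !cabs_real (ger0_norm u0) ger0_norm ?mulr_ge0 ?pi_ge0 //.
  have a1 : cabs (g * u%:C - lam * u%:C) <= 2 * (B * X * u).
    by apply: (le_trans (cabsB _ _)); lra.
  have a2 : cabs z * cabs (g * u%:C - lam * u%:C) <= (B * X) * (2 * (B * X * u)).
    by apply: ler_pM; rewrite ?cabs_ge0.
  have a3 : cabs h1 * u * (2 * pi) <= B * u * 8.
    apply: ler_pM; rewrite ?mulr_ge0 ?cabs_ge0 ?pi_ge0 //; first by rewrite ler_wpM2r.
    by have := @pi_le4 R; lra.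
  rewrite (_ : cabs h1 * u * _ = (cabs h1 * u * (2 * pi)) *
     ((cabs z * cabs (g * u%:C - lam * u%:C)) * cabs (gauss z))); last by ring.
  apply: (@le_trans _ _ ((B * u * 8) * (((B * X) * (2 * (B * X * u))) * cabs (gauss z)))).
    apply: ler_pM => //; rewrite ?mulr_ge0 ?cabs_ge0 ?pi_ge0 //.
    by rewrite ler_wpM2r.
  rewrite (_ : _ * _ = 16 * B ^+ 3 * (w * (cabs (gauss z) * X ^+ 2))); last by rewrite /w; ring.
  by rewrite ler_wpM2l ?ler_wpM2l // mulr_ge0 // exprn_ge0.
rewrite (mulrBr (h1 * u%:C)).
apply: (le_trans (cabsD _ _)).
have := cabsB (lam * r1) (g * r2).
have := cabsB (h1 * u%:C * (r1 - r2)) (h1 * u%:C * ((2 * pi)%:C * z * (g * u%:C - lam * u%:C) * gauss z)).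
by lra.
Qed.

Lemma sector_convex d B (lam0 s0 lam1 s1 : R[i]) t : 0 <= t <= 1 ->
  sector d B lam0 s0 -> sector d B lam1 s1 ->
  sector d B (lam0 + (lam1 - lam0) * t%:C) (s0 + (s1 - s0) * t%:C).
Proof.
move=> /andP[t0 t1] [a1 a2 a3] [b1 b2 b3].
have cvx a b : cabs a <= B -> cabs b <= B -> cabs (a + (b - a) * t%:C) <= B.
  move=> ha hb; rewrite (_ : _ + _ = a * (1 - t)%:C + b * t%:C); last first.
    by rewrite rmorphB /=; ring.
  apply: (le_trans (cabsD _ _)); rewrite !cabsM !cabs_real !ger0_norm ?subr_ge0 //.
  have ha' : cabs a * (1 - t) <= B * (1 - t) by rewrite ler_wpM2r ?subr_ge0.
  by have hb' : cabs b * t <= B * t; [rewrite ler_wpM2r | lra].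
split; [|exact: cvx|exact: cvx].
have -> : Re (lam0 + (lam1 - lam0) * t%:C) = (1 - t) * Re lam0 + t * Re lam1.
  by case: (lam0) => ? ?; case: (lam1) => ? ? /=; ring.
have -> : Im (lam0 + (lam1 - lam0) * t%:C) = (1 - t) * Im lam0 + t * Im lam1.
  by case: (lam0) => ? ?; case: (lam1) => ? ? /=; ring.
have := ler_normD ((1 - t) * Im lam0) (t * Im lam1).
rewrite !normrM (ger0_norm t0) (ger0_norm (_ : 0 <= 1 - t)) ?subr_ge0 //.
have a1' : (1 - t) * d <= (1 - t) * (Re lam0 - `|Im lam0|) by rewrite ler_wpM2l ?subr_ge0.
by have b1' : t * d <= t * (Re lam1 - `|Im lam1|); [rewrite ler_wpM2l | lra].
Qed.

Lemma sector_exists (lam0 s0 lam1 s1 : R[i]) :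
  `|Im lam0| < Re lam0 -> `|Im lam1| < Re lam1 ->
  exists d B, [/\ 0 < d, 1 <= B, sector d B lam0 s0, sector d B lam1 s1
    & cabs (lam1 - lam0) <= B /\ cabs (s1 - s0) <= B].
Proof.
move=> h0 h1.
exists (Num.min (Re lam0 - `|Im lam0|) (Re lam1 - `|Im lam1|)).
exists (1 + cabs lam0 + cabs lam1 + cabs s0 + cabs s1).
have c1 := cabs_ge0 lam0; have c2 := cabs_ge0 lam1.
have c3 := cabs_ge0 s0; have c4 := cabs_ge0 s1.
split.
- by rewrite lt_min !subr_gt0 h0.
- by lra.
- by split; [rewrite ge_min lexx|lra|lra].
- by split; [rewrite ge_min lexx orbT|lra|lra].
by have := cabsB lam1 lam0; have := cabsB s1 s0; lra.
Qed.

(** The segment between the parameters is crossed in N steps of length 1/N, equal to the mesh, so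
    that a shift by one node absorbs each first-order change. N errors of order 1/N^2 remain. *)
Lemma avg_dilate (lam0 s0 lam1 s1 : R[i]) :
  `|Im lam0| < Re lam0 -> `|Im lam1| < Re lam1 ->
  exists2 M, 0 <= M & exists N0 : nat, forall N, (N0 <= N)%N -> (0 < N)%N ->
    cabs (avg N (dilate lam1 s1) - avg N (dilate lam0 s0)) <= M / N%:R.
Proof.
move=> hl0 hl1.
have [d [B [d0 B1 sec0 sec1 [hh1 hh2]]]] := sector_exists s0 s1 hl0 hl1.
have [K [u0 [K0 u00 hstep]]] := dilate_step d0 B1.
have [L L0 hL] := gauss_rdecay B d0.
have [P P0 hP] := primitive_rdecay B d0.
have B0 : 0 <= B by lra.
exists (20 * K); first by rewrite mulr_ge0.
exists (Num.bound `|u0^-1|) => N hN Npos.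
have Nr : 0 < N%:R :> R by rewrite ltr0n.
have Nu : 0 <= (N%:R^-1 : R) <= u0.
  rewrite invr_ge0 ltW //= -[u0]invrK lef_pV2 ?posrE ?invr_gt0 //.
  apply: (le_trans (ler_norm _)); apply: (le_trans (ltW (archi_boundP (normr_ge0 _)))).
  by rewrite ler_nat.
pose l i : R[i] := lam0 + (lam1 - lam0) * (i%:R / N%:R)%:C.
pose s i : R[i] := s0 + (s1 - s0) * (i%:R / N%:R)%:C.
have sec i : (i <= N)%N -> sector d B (l i) (s i).
  move=> hi; apply: sector_convex => //.
  by rewrite divr_ge0 //= ler_pdivrMr // mul1r ler_nat.
have dec i : (i <= N)%N -> rdecay (dilate (l i) (s i)) (B * L).
  move=> hi x; have [_ hl _] := sec i hi.
  by rewrite /dilate cabsM -mulrA ler_pM ?cabs_ge0 // (hL _ _ (sec i hi)).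
have fr i : i.+1%:R / N%:R = i%:R / N%:R + N%:R^-1 :> R by rewrite -natr1 mulrDl mul1r.
have e0 : dilate lam0 s0 = dilate (l 0) (s 0).
  by rewrite /l /s mul0r !mulr0 !addr0.
have e1 : dilate lam1 s1 = dilate (l N) (s N).
  by rewrite /l /s divff ?gt_eqF // !mulr1 !(addrC _ (_ - _)) !subrK.
rewrite e0 e1 -(telescope_sumr (fun i => avg N (dilate (l i) (s i))) (leq0n N)).
apply: (le_trans (cabs_sum _ _ _)).
apply: (@le_trans _ _ (\sum_(0 <= i < N) 20 * (K * N%:R^-1 ^+ 2))).
  apply: ler_sum_nat => i /andP[_ hi].
  apply: (avg_step Npos (dec i (ltnW hi)) (dec i.+1 hi) (hP _ _ _ _ (sec i (ltnW hi)) hh1 hh2)).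
  move=> x; have := hstep (l i) (s i) _ _ x N%:R^-1 (sec i (ltnW hi)) hh1 hh2 Nu.
  rewrite (_ : l i + _ = l i.+1); last first.
    by rewrite /l fr rmorphD /= mulrDr addrA.
  rewrite (_ : s i + _ = s i.+1) //.
  by rewrite /s fr rmorphD /= mulrDr addrA.
rewrite sumr_const_nat subn0 -[X in X <= _]mulr_natl.
rewrite (_ : _ * _ = 20 * K / N%:R) //.
by field; rewrite gt_eqF.
Qed.

End Contour.

(** * Poisson summation for Gaussians *)

Section Poisson.
Variable R : realType.
Implicit Types (x u t d B c M : R) (z lam s : R[i]) (k : int) (N K : nat).

Lemma epiE t : epi t = cexp ('i%C * (pi * t)%:C).
Proof. by rewrite /epi; congr cexp; apply/eqP; rewrite eq_complex /=; apply/andP; split; apply/eqP; ring. Qed.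

Lemma cabs_epi t : cabs (epi t) = 1.
Proof. by rewrite /epi cabs_cexp expR0. Qed.

Lemma cabs_nat n : cabs (n%:R : R[i]) = n%:R.
Proof. by rewrite -(rmorph_nat (real_complex R)) cabs_real normr_nat. Qed.

Lemma epiMz t k : epi (t *~ k) = epi t ^ k.
Proof.
case: k => n; first by rewrite -pmulrn -exprnP epiX.
by rewrite NegzE mulrNz -pmulrn epiN -epiX exprnN.
Qed.

Lemma epi2 : epi (2 : R) = 1.
Proof. by rewrite (_ : 2 = 1 + 1) // epiD epi1 mulrNN mulr1. Qed.

Lemma epi_2int k : epi (2 * k%:~R : R) = 1.
Proof. by rewrite mulrzr epiMz epi2 exp1rz. Qed.

(** A weak Jordan inequality: sin y >= y - y^2 for y = pi t up to 1/2, then monotonicity and sin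
    (1/2) >= 1/4. *)
Lemma sin_pi_ge t : 0 <= t <= 1 / 2 -> t / 2 <= sin (pi * t).
Proof.
move=> /andP[t0 t1]; have p2 := pi_ge2 R; have p4 := @pi_le4 R.
have low (y : R) : 0 <= y -> y - y ^+ 2 <= sin y.
  by move=> y0; have := sin_sub_bound y; rewrite ler_norml => /andP[]; lra.
have pt0 : 0 <= pi * t by rewrite mulr_ge0 // ltW // (lt_le_trans _ p2).
have [h|h] := lerP (pi * t) (1 / 2).
  by have := low _ pt0; nra.
have h2 : sin (1 / 2 : R) <= sin (pi * t).
  have itv (y : R) : 0 <= y <= pi / 2 -> y \in `[(- (pi / 2)), (pi / 2)].
    by rewrite in_itv /= => /andP[a b]; rewrite b andbT; lra.
  apply: ltW; rewrite ltr_sin //; apply: itv.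
    by apply/andP; split; lra.
  by rewrite pt0 /= ler_wpM2l ?pi_ge0 //; lra.
by apply: le_trans h2; have := low (1 / 2) ltac:(lra); lra.
Qed.

Lemma cabs_epi_sub1 t : cabs (epi (2 * t) - 1) ^+ 2 = 4 * sin (pi * t) ^+ 2.
Proof.
rewrite cabs_sqr /epi /= expR0 !mul1r subr0.
rewrite (_ : (cos _ - 1) ^+ 2 + _ = 2 * (1 - cos (pi * (2 * t)))); last first.
  by have := cos2Dsin2 (pi * (2 * t)); set a := cos _; set b := sin _ => h; lra.
rewrite one_sub_cos (_ : pi * (2 * t) / 2 = pi * t); last by field.
by ring.
Qed.

Lemma epi_neq1 t : 0 < t < 1 -> epi (2 * t) != 1.
Proof.
move=> /andP[t0 t1]; apply/eqP => h; have := cabs_epi_sub1 t.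
rewrite h subrr cabs0 expr0n /= => /esym/eqP; rewrite mulf_eq0 pnatr_eq0 /= sqrf_eq0.
apply/negP; rewrite gt_eqF // sin_gt0_pi // mulr_gt0 ?pi_gt0 //=.
by rewrite -[X in _ < X]mulr1 ltr_pM2l ?pi_gt0.
Qed.

Lemma cabs_epi_sub1_ge t : `|t| <= 1 / 2 -> t ^+ 2 <= cabs (epi (2 * t) - 1) ^+ 2.
Proof.
move=> ht; rewrite cabs_epi_sub1.
have -> : sin (pi * t) ^+ 2 = sin (pi * `|t|) ^+ 2.
  by have [t0|t0] := ger0P t; rewrite ?mulrN ?sinN ?sqrrN.
rewrite -(real_normK (num_real t)).
have := @sin_pi_ge `|t|; rewrite normr_ge0 ht => /(_ isT).
have := normr_ge0 t; nra.
Qed.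

(** Orthogonality of the characters of Z/N; the frequencies fill the symmetric range from -K to K,
    which makes N odd. *)
Lemma dft_sum N K (j : nat) : N = (2 * K).+1 -> (j < N)%N ->
  \sum_(i < N) epi (- (2 * (i%:Z - K%:Z)%:~R * (j%:R / N%:R)) : R) = if j == 0%N then N%:R else 0.
Proof.
move=> NE jN.
have N0 : (0 < N%:R :> R) by rewrite ltr0n NE.
have [->|j0] := eqVneq j 0%N.
  under eq_bigr do rewrite mul0r mulr0 oppr0 epi0.
  by rewrite sumr_const card_ord.
pose w : R[i] := epi (2 * - (j%:R / N%:R)).
have hw i : epi (- (2 * (i%:Z - K%:Z)%:~R * (j%:R / N%:R)) : R) =
   epi (2 * K%:R * (j%:R / N%:R)) * w ^+ i.
  rewrite /w epiX -epiD; congr epi; rewrite intrD mulrNz -!pmulrn -mulr_natr; ring.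
under eq_bigr do rewrite hw.
rewrite -big_distrr /=.
have w1 : w != 1.
  rewrite /w mulrN epiN invr_eq1; apply: epi_neq1.
  by rewrite divr_gt0 /= ?ltr_pdivrMr ?mul1r ?ltr_nat ?ltr0n ?lt0n ?NE // -NE.
have wN : w ^+ N = 1.
  rewrite /w epiX (_ : _ *+ N = 2 * (- j%:Z)%:~R); first exact: epi_2int.
  by rewrite mulrNz -pmulrn -mulr_natr; field; rewrite gt_eqF.
have := subrX1 w N; rewrite wN subrr => /esym/eqP; rewrite mulf_eq0 subr_eq0 (negPf w1) /= => /eqP ->.
by rewrite mulr0.
Qed.

Definition fourier_gauss lam s k x : R[i] :=
  epi (- (2 * k%:~R * x)) * gauss (lam * x%:C + s).

Lemma epi_frac k (n : int) x : epi (- (2 * k%:~R * (n%:~R + x))) = epi (- (2 * k%:~R * x)) :> R[i].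
Proof.
rewrite mulrDr opprD epiD (_ : - (2 * k%:~R * n%:~R) = 2 * (- (k * n))%:~R).
  by rewrite epi_2int mul1r.
by rewrite rmorphN rmorphM /=; ring.
Qed.

(** Exact for every odd N: a character of integer frequency sees only the fractional part of a node,
    so the averages are the discrete Fourier coefficients of the periodised Gaussian sampled at j/N,
    and summing them recovers the sample at 0. *)
Lemma dft_inversion lam s N K M : N = (2 * K).+1 -> rdecay (fun x => gauss (lam * x%:C + s)) M ->
  zsum (fun n => gauss (lam * (n%:~R)%:C + s)) = zpart (fun k => avg N (fourier_gauss lam s k)) K.
Proof.
move=> NE gM; pose g j := zsum (fun n => gauss (lam * (n%:~R + j%:R / N%:R)%:C + s)).
have N0 : (N%:R : R) != 0 by rewrite NE pnatr_eq0.
have hA k : avg N (fourier_gauss lam s k) =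
    (N%:R^-1)%:C * \sum_(j < N) epi (- (2 * k%:~R * (j%:R / N%:R))) * g j.
  rewrite /avg; congr (_ * _); apply: eq_bigr => j _.
  rewrite /g -(zsumZ _ (zdecay_rdecay gM (ord_frac_itv R j))).
  by apply: eq_zsum => n; rewrite /fourier_gauss epi_frac.
rewrite /zpart -NE; under eq_bigr do rewrite hA.
rewrite -big_distrr /= exchange_big /=.
under eq_bigr => j _ do rewrite -big_distrl /= (dft_sum NE (ltn_ord j)).
have <- : g 0%N = zsum (fun n => gauss (lam * (n%:~R)%:C + s)).
  by apply: eq_zsum => n; rewrite mul0r addr0.
clearbody g; case: N NE N0 {gM hA} => // N NE N0.
rewrite big_ord_recl big1 ?addr0 /= => [|j _]; last by rewrite mul0r.
by rewrite mulrA -(rmorph_nat (real_complex R)) -rmorphM mulVf // rmorph1 mul1r.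
Qed.

(** Completing the square: the character moves [s] by i k / lam and splits off a constant, the later
    [dual_term]. *)
Lemma fourier_gaussE lam s k x : lam != 0 ->
  fourier_gauss lam s k x =
  cexp (- (pi%:C * s ^+ 2)) * gauss (lam^-1 * (k%:~R)%:C - 'i%C * s) *
    gauss (lam * x%:C + (s + 'i%C * (k%:~R)%:C / lam)).
Proof.
move=> l0; pose v := 'i%C * (k%:~R)%:C / lam.
have hv : v * lam = 'i%C * (k%:~R)%:C by rewrite /v divfK.
have i2 : 'i%C * 'i%C = -1 :> R[i] by rewrite -expr2 sqr_i.
have hk : lam^-1 * (k%:~R)%:C = - 'i%C * v.
  by rewrite /v !mulrA mulNr i2 opprK mul1r mulrC.
rewrite /fourier_gauss /gauss epiE -!cexpD hk -/v; congr cexp.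
rewrite (_ : (- 'i%C * v - 'i%C * s) ^+ 2 = - (v + s) ^+ 2); last first.
  rewrite (_ : - 'i%C * v - 'i%C * s = - 'i%C * (v + s)); last by ring.
  by rewrite exprMn sqrrN expr2 i2 mulN1r.
rewrite (_ : 'i%C * (pi * - (2 * k%:~R * x))%:C = - (2%:R * pi%:C * x%:C * (v * lam))); last first.
  by rewrite hv mulrN rmorphN !rmorphM /= rmorph_nat; ring.
by ring.
Qed.

(** Two summations by parts. With w = e^(2 pi i k / N), the twisted second difference of the summand
    is O(1/N^2) and its average is (w - 1)^2 times the wanted one, while |w - 1| >= |k| / N as long
    as |k| <= N / 2. *)
Lemma avg_fourier_bound lam s : `|Im lam| < Re lam ->
  exists2 M, 0 <= M & exists N0 : nat, forall N k, (N0 <= N)%N -> (0 < N)%N ->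
    (2 * `|k| <= N)%N -> cabs (avg N (fourier_gauss lam s k)) * (k%:~R ^+ 2) <= M.
Proof.
move=> hl; have [d [B' [d0 B1' [sd hB0 hs0] _ _]]] := sector_exists s s hl hl.
(* Doubled because the second difference also moves the argument by [2 * lam * u]. *)
pose B := 2 * B'; have B1 : 1 <= B by rewrite /B; lra.
have sec : sector d B lam s by split=> //; rewrite /B; lra.
have [K1 [u0 [K10 u00 hrem]]] := gauss_rem_dom d0 B1.
have [L L0 hL] := gauss_rdecay B d0; have gL := hL _ _ sec.
exists (60 * K1); first by rewrite mulr_ge0.
exists (Num.bound `|u0^-1|) => N k hN Npos hk.
have Nr : 0 < N%:R :> R by rewrite ltr0n.
pose u : R := N%:R^-1.
have u0' : 0 <= u by rewrite invr_ge0 ltW.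
have uu0 : u <= u0.
  rewrite /u -[u0]invrK lef_pV2 ?posrE ?invr_gt0 //.
  apply: (le_trans (ler_norm _)); apply: (le_trans (ltW (archi_boundP (normr_ge0 _)))).
  by rewrite ler_nat.
have u1 : 0 <= u <= 1 by rewrite u0' /u invf_le1 // ler1n.
pose f := fourier_gauss lam s k; pose w : R[i] := epi (2 * (k%:~R * u)).
have fL : rdecay f L by move=> x; rewrite /f /fourier_gauss cabsM cabs_epi mul1r; exact: gL.
have fL1 := rdecay_shift fL u1; have fL2 := rdecay_shift fL1 u1.
(* The powers of [w] undo the phases of the shifts, leaving an ordinary second difference of the
   Gaussian, in which constant and linear Taylor terms cancel. *)
have E x : w ^+ 2 * f (x + u + u) - (2 * w * f (x + u) - f x) =
    epi (- (2 * k%:~R * x)) * (gauss_rem (lam * x%:C + s) (2%:R * lam * u%:C)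
       - 2%:R * gauss_rem (lam * x%:C + s) (lam * u%:C)).
  rewrite /f /fourier_gauss /gauss_rem.
  rewrite (_ : lam * (x + u + u)%:C + s = lam * x%:C + s + 2%:R * lam * u%:C); last first.
    by rewrite !rmorphD /=; ring.
  rewrite (_ : lam * (x + u)%:C + s = lam * x%:C + s + lam * u%:C); last first.
    by rewrite !rmorphD /=; ring.
  rewrite (_ : epi (- (2 * k%:~R * (x + u))) = epi (- (2 * k%:~R * x)) / w :> R[i]); last first.
    by rewrite /w -epiN -epiD; congr epi; ring.
  rewrite (_ : epi (- (2 * k%:~R * (x + u + u))) = epi (- (2 * k%:~R * x)) / w / w :> R[i]); last first.
    by rewrite /w -epiN -!epiD; congr epi; ring.
  rewrite !rmorphM /= rmorph_nat.
  have w0 : w != 0 by exact: cexp_neq0.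
  by field.
have hE : rdecay (fun x => w ^+ 2 * f (x + u + u) - (2 * w * f (x + u) - f x)) (3 * K1 * u ^+ 2).
  move=> x; rewrite E cabsM cabs_epi mul1r; apply: (le_trans (cabsB _ _)).
  have X1 : 1 <= `|x| + 1 by rewrite lerDr.
  have bl : cabs lam * u <= B' * (`|x| + 1) * u.
    by rewrite ler_wpM2r // (le_trans hB0) // ler_peMr //; lra.
  have y1 : cabs (2%:R * lam * u%:C) <= B * (`|x| + 1) * u.
    by rewrite !cabsM cabs_nat cabs_real (ger0_norm u0') /B; lra.
  have y2 : cabs (lam * u%:C) <= B * (`|x| + 1) * u.
    rewrite cabsM cabs_real ger0_norm //; apply: (le_trans bl).
    by rewrite ler_wpM2r // ler_wpM2r /B //; lra.
  have q1 := hrem _ _ x u _ sec ltac:(by rewrite u0') y1.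
  have q2 := hrem _ _ x u _ sec ltac:(by rewrite u0') y2.
  have q1' := le_trans (ler_peMr (cabs_ge0 _) X1) q1.
  have q2' := le_trans (ler_peMr (cabs_ge0 _) X1) q2.
  by rewrite cabsM cabs_nat; lra.
have := avg_bound N hE.
have c1 : rdecay (fun x => 2 * w * f (x + u)) (cabs (2 * w) * (4 * L)).
  by move=> x; rewrite cabsM -mulrA ler_wpM2l ?cabs_ge0 // fL1.
have c2 : rdecay (fun x => w ^+ 2 * f (x + u + u)) (cabs (w ^+ 2) * (4 * (4 * L))).
  by move=> x; rewrite cabsM -mulrA ler_wpM2l ?cabs_ge0 // fL2.
rewrite (avgB N c2 (rdecayB c1 fL)) (avgB N c1 fL) (avgZ N _ fL2) (avgZ N _ fL1).
rewrite (avg_shift N fL1) (avg_shift N fL) -/f; set A := avg N f.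
rewrite (_ : _ - _ = (w - 1) ^+ 2 * A); last by ring.
rewrite (cabsM _ A) expr2 cabsM -expr2 => hA.
have ht : `|k%:~R * u| <= 1 / 2.
  rewrite normrM (ger0_norm u0') -intr_norm -abszE -pmulrn /u ler_pdivrMr //.
  have : ((2 * `|k|)%:R <= N%:R :> R) by rewrite ler_nat.
  by rewrite natrM; lra.
have hw := cabs_epi_sub1_ge ht; rewrite -/w exprMn in hw.
have hh : (k%:~R ^+ 2 * u ^+ 2) * cabs A <= 60 * K1 * u ^+ 2.
  by apply: (le_trans (ler_wpM2r (cabs_ge0 A) hw)); lra.
have u2 : 0 < u ^+ 2 by rewrite exprn_gt0 // invr_gt0.
by rewrite -(ler_pM2r u2); lra.
Qed.

End Poisson.

(** * The limit in the discrete Poisson formula *)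

Section Inversion.
Variable R : realType.
Implicit Types (x d B c M eps : R) (z lam s : R[i]) (k : int) (N K n : nat).

Definition upper_wedge lam := `|Im lam| < Re lam.

Lemma wedge_neq0 lam : upper_wedge lam -> lam != 0.
Proof. by move=> h; apply: contraPneq h => ->; rewrite /upper_wedge /= normr0 ltxx. Qed.

Lemma wedgeV lam : upper_wedge lam -> upper_wedge lam^-1.
Proof.
rewrite /upper_wedge; case: lam => p q /= h.
have p0 : 0 < p by apply: le_lt_trans h.
have D : 0 < p ^+ 2 + q ^+ 2 by rewrite ltr_wpDr ?sqr_ge0 // exprn_gt0.
by rewrite normrN normrM normfV (gtr0_norm D) ltr_pM2r // invr_gt0.
Qed.

Lemma divn_small M eps : 0 < eps -> exists N0 : nat, forall N, (N0 <= N)%N -> (0 < N)%N -> M / N%:R <= eps.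
Proof.
move=> e0; exists (Num.bound `|M / eps|) => N hN Npos.
rewrite ler_pdivrMr ?ltr0n // mulrC -ler_pdivrMr //.
apply: (le_trans (ler_norm _)); apply: (le_trans (ltW (archi_boundP (normr_ge0 _)))).
by rewrite ler_nat.
Qed.

Lemma sum_unif_small (F : nat -> nat -> R) n :
  (forall i, exists2 M, 0 <= M & exists N0 : nat, forall N, (N0 <= N)%N -> (0 < N)%N -> F N i <= M / N%:R) ->
  exists2 M, 0 <= M & exists N0 : nat, forall N, (N0 <= N)%N -> (0 < N)%N ->
    \sum_(i < n) F N i <= M / N%:R.
Proof.
move=> h; elim: n => [|n [M M0 [N0 hN]]].
  by exists 0 => //; exists 0%N => N _ _; rewrite big_ord0 mul0r.
have [M' M'0 [N' hN']] := h n.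
exists (M + M'); first exact: addr_ge0.
exists (maxn N0 N') => N; rewrite geq_max => /andP[h1 h2] Npos.
by rewrite big_ord_recr /= mulrDl lerD ?hN ?hN'.
Qed.

(** Telescoping with 1/(p+1)^2 <= 1/p - 1/(p+1). *)
Lemma zpart_tail (f : int -> R[i]) M K n : 0 <= M -> (0 < n)%N -> (n <= K)%N ->
  (forall k, (0 < `|k|)%N -> (`|k| <= K)%N -> cabs (f k) * k%:~R ^+ 2 <= M) ->
  cabs (zpart f K - zpart f n) <= 2 * M / n%:R.
Proof.
move=> M0 n0 nK hf; suff h m : (n + m <= K)%N ->
    cabs (zpart f (n + m) - zpart f n) <= 2 * M * (n%:R^-1 - (n + m)%:R^-1).
  rewrite -(subnKC nK); apply: le_trans (h _ _) _; first by rewrite subnKC.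
  by rewrite ler_wpM2l ?mulr_ge0 // gerBl invr_ge0.
elim: m => [|m IH] hm; first by rewrite addn0 !subrr cabs0 mulr0.
rewrite addnS zpartS addrAC; apply: (le_trans (cabsD _ _)).
have hm' : ((n + m).+1 <= K)%N by rewrite -addnS.
have := IH (ltnW hm').
set p := (n + m)%N in hm' *.
have p0 : (0 < p%:R :> R) by rewrite ltr0n /p addn_gt0 n0.
have q0 : (0 < p.+1%:R :> R) by rewrite ltr0n.
have bd k : `|k|%N = p.+1 -> cabs (f k) <= M / p.+1%:R ^+ 2.
  move=> hk; rewrite ler_pdivlMr ?exprn_gt0 //.
  have := hf k; rewrite hk => /(_ isT hm').
  by rewrite -(real_normK (num_real (k%:~R : R))) -intr_norm -abszE hk -pmulrn.
have b1 := bd p.+1%:Z erefl; have b2 := bd (- p.+1%:Z) (abszN _).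
have b3 := cabsD (f p.+1%:Z) (f (- p.+1%:Z)).
have b4 : M / p.+1%:R ^+ 2 <= M * (p%:R^-1 - p.+1%:R^-1).
  rewrite ler_wpM2l // -subr_ge0.
  rewrite (_ : _ - _ = (p%:R * p.+1%:R ^+ 2)^-1); first by rewrite invr_ge0 mulr_ge0 ?exprn_ge0 // ltW.
  by rewrite -natr1; field; rewrite natr1 !gt_eqF.
move: (le_trans b1 b4) (le_trans b2 b4) b3 => {bd b1 b2 b4}.
by move: (p.+1%:R^-1) (p%:R^-1) (n%:R^-1) => ? ? ?; lra.
Qed.

(** This is e^(-pi k^2 / lam^2 + 2 pi i k s / lam), that is lam times the Fourier transform of the
    Gaussian at k, written as a Gaussian again so that the same decay lemmas apply. *)
Definition dual_term lam s k : R[i] :=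
  cexp (- (pi%:C * s ^+ 2)) * gauss (lam^-1 * (k%:~R)%:C - 'i%C * s).

Lemma dual_term_decay lam s : upper_wedge lam -> exists L, zdecay (dual_term lam s) L.
Proof.
move=> hl; have hv := wedgeV hl.
have [d [B [d0 _ sec _ _]]] := sector_exists (- ('i%C * s)) (- ('i%C * s)) hv hv.
have [L L0 hL] := gauss_rdecay B d0.
exists (cabs (cexp (- (pi%:C * s ^+ 2))) * (4 * L)); apply: zdecayZ => k.
have h01 : 0 <= (0 : R) <= 1 by rewrite lexx ler01.
by have := zdecay_rdecay (hL _ _ sec) h01 k; rewrite addr0.
Qed.

Lemma gauss_zdecay lam s : upper_wedge lam ->
  exists L, zdecay (fun n : int => gauss (lam * (n%:~R)%:C + s)) L.
Proof.
move=> hl; have [d [B [d0 _ sec _ _]]] := sector_exists s s hl hl.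
have [L L0 hL] := gauss_rdecay B d0; exists (4 * L) => k.
have h01 : 0 <= (0 : R) <= 1 by rewrite lexx ler01.
by have := zdecay_rdecay (hL _ _ sec) h01 k; rewrite addr0.
Qed.

Lemma wedge1 : upper_wedge 1.
Proof. by rewrite /upper_wedge /= normr0 ltr01. Qed.

(** The cut-off [n] is fixed before N. The frequencies beyond it cost eps/3 by the k^-2 bound, the
    finitely many others eps/3 by [avg_dilate], the tail of the dual series eps/3. The average of
    the standard Gaussian is kept as an unknown factor. *)
Lemma poisson_approx lam s eps : upper_wedge lam -> 0 < eps ->
  exists K0 : nat, forall K, (K0 <= K)%N ->
    cabs (lam * zsum (fun n : int => gauss (lam * (n%:~R)%:C + s))
      - avg (2 * K).+1 (dilate 1 0) * zsum (dual_term lam s)) <= eps.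
Proof.
move=> hl e0; have l0 := wedge_neq0 hl.
have [L hL] := dual_term_decay s hl.
have [d1 [B1 [d10 _ sec1 _ _]]] := sector_exists 0 0 wedge1 wedge1.
have [L1 L10 hL1] := gauss_rdecay B1 d10.
have [d [B [d0 _ sec _ _]]] := sector_exists s s hl hl.
have [L2 L20 hL2] := gauss_rdecay B d0; have gL2 := hL2 _ _ sec.
have hr N : cabs (avg N (dilate 1 0)) <= 20 * L1.
  by apply: avg_bound => x; rewrite /dilate mul1r; exact: (hL1 _ _ sec1).
have [M M0 [Nb hb]] := avg_fourier_bound s hl.
have e3 : 0 < eps / 3 by rewrite divr_gt0.
have [n1 hn1] := divn_small (cabs lam * (2 * M)) e3.
have [n2 hn2] := half_expn_lt (20 * L1 * (4 * L)) e3.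
pose n := (maxn n1 n2).+1.
have hN1 : cabs lam * (2 * M) / n%:R <= eps / 3.
  by apply: hn1 => //; rewrite /n leqW // leq_maxl.
have hN2 : 20 * L1 * (4 * L) * 2^-1 ^+ n <= eps / 3.
  by apply/ltW/hn2; rewrite /n leqW // leq_maxr.
pose A N k := avg N (fourier_gauss lam s k).
have hA k : exists2 M, 0 <= M & exists N0 : nat, forall N, (N0 <= N)%N -> (0 < N)%N ->
    cabs (lam * A N k - avg N (dilate 1 0) * dual_term lam s k) <= M / N%:R.
  (* The constants of [avg_dilate] depend on this shift, hence on [k]. *)
  pose s' := s + 'i%C * (k%:~R)%:C / lam.
  have [M' M'0 [N' hN']] := avg_dilate 0 s' wedge1 hl.
  exists (cabs (dual_term lam s k) * M'); first by rewrite mulr_ge0 ?cabs_ge0.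
  exists N' => N h1 h2.
  have -> : lam * A N k = dual_term lam s k * avg N (dilate lam s').
    have [d' [B' [d'0 _ sec' _ _]]] := sector_exists s' s' hl hl.
    have [L' L'0 hL'] := gauss_rdecay B' d'0; have gL' := hL' _ _ sec'.
    rewrite /A (_ : fourier_gauss lam s k =
       fun x => dual_term lam s k * gauss (lam * x%:C + s')); last first.
      by apply/funext => x; rewrite fourier_gaussE.
    by rewrite (avgZ N _ gL') /dilate (avgZ N _ gL') mulrCA.
  rewrite (mulrC (avg _ _)) -mulrBr cabsM -mulrA ler_wpM2l ?cabs_ge0 //.
  exact: hN'.
have [M3 M30 [N3 hN3]] := sum_unif_small (F := fun N i => cabs (lam * A N (i%:Z - n%:Z)
  - avg N (dilate 1 0) * dual_term lam s (i%:Z - n%:Z))) (2 * n).+1 (fun i => hA (i%:Z - n%:Z)).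
have [n4 hn4] := divn_small M3 e3.
exists (maxn (maxn Nb n) (maxn N3 n4)) => K; rewrite !geq_max => /andP[/andP[k1 k2] /andP[k3 k4]].
set N := (2 * K).+1.
have KN : (K <= N)%N by rewrite /N; lia.
rewrite (dft_inversion (N := N) (K := K) erefl gL2) -/(A N).
set r := avg N (dilate 1 0).
have t1 : cabs (zpart (A N) K - zpart (A N) n) <= 2 * M / n%:R.
  apply: zpart_tail => // k _ hk; apply: hb => //.
    exact: leq_trans k1 KN.
  by rewrite /N; lia.
have t2 : cabs (lam * zpart (A N) n - r * zpart (dual_term lam s) n) <= eps / 3.
  rewrite /zpart !big_distrr -sumrB.
  apply: (le_trans (cabs_sum _ _ _)); apply: (le_trans (hN3 N (leq_trans k3 KN) isT)).
  by apply: hn4 => //; exact: leq_trans k4 KN.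
have t3 : cabs (r * (zpart (dual_term lam s) n - zsum (dual_term lam s))) <= eps / 3.
  have := zsum_error n hL; rewrite cabs_distC => z1.
  by apply: le_trans hN2; rewrite cabsM -mulrA; apply: ler_pM z1; rewrite ?cabs_ge0 ?hr.
rewrite (_ : _ - _ = lam * (zpart (A N) K - zpart (A N) n)
  + (lam * zpart (A N) n - r * zpart (dual_term lam s) n)
  + r * (zpart (dual_term lam s) n - zsum (dual_term lam s))); last by ring.
apply: (le_trans (cabsD _ _)); apply: (@le_trans _ _ (eps / 3 + eps / 3 + eps / 3)); last by lra.
apply: lerD t3; apply: (le_trans (cabsD _ _)); apply: lerD t2.
by rewrite cabsM; apply: le_trans hN1; rewrite -mulrA ler_wpM2l ?cabs_ge0.
Qed.

Lemma dual_term1 k : dual_term 1 0 k = gauss (1 * (k%:~R)%:C + 0) :> R[i].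
Proof. by rewrite /dual_term invr1 expr2 !mulr0 oppr0 cexp0 mul1r. Qed.

Lemma gauss_real x : gauss x%:C = (expR (- (pi * x ^+ 2)))%:C.
Proof.
rewrite /gauss -rmorphXn -rmorphM -rmorphN.
by apply/eqP; rewrite eq_complex /= cos0 sin0 mulr1 mulr0 !eqxx.
Qed.

(** Nonnegative terms with central term 1 keep the partial sums at least 1. *)
Lemma zsum_gauss_neq0 : zsum (fun n : int => gauss (1 * (n%:~R)%:C + 0) : R[i]) != 0.
Proof.
have [L hL] := gauss_zdecay 0 wedge1.
apply/eqP => h0; have [n hn] := half_expn_lt (4 * L) (@ltr01 R).
have := le_lt_trans (zsum_error n hL) (hn n (leqnn n)).
rewrite h0 sub0r cabsN; apply/negP; rewrite -leNgt.
apply: le_trans (le_Re_cabs _); apply: le_trans (ler_norm _).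
have g0 (k : int) : 0 <= Re (gauss (1 * (k%:~R)%:C + 0) : R[i]).
  by rewrite mul1r addr0 gauss_real /= expR_ge0.
have : forall m, 1 <= Re (zpart (fun n : int => gauss (1 * (n%:~R)%:C + 0) : R[i]) m).
  elim=> [|m IH].
    by rewrite zpart0 mul1r addr0 gauss_real expr0n mulr0 oppr0 expR0 lexx.
  by rewrite zpartS !raddfD; have := g0 m.+1%:Z; have := g0 (- m.+1%:Z); lra.
exact.
Qed.

(* The limit [1] of the averages is read off the case [lam = 1], [s = 0], where both sides are
   the same nonzero sum. *)
Lemma gauss_inversion lam s : upper_wedge lam ->
  lam * zsum (fun n : int => gauss (lam * (n%:~R)%:C + s)) = zsum (dual_term lam s).
Proof.
move=> hl; set P := lam * _; set G := zsum _.
apply/eqP; rewrite -subr_eq0; apply/eqP/cabs_eq0/le_anti; rewrite cabs_ge0 andbT.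
apply/ler_addgt0Pl => e e0; rewrite addr0.
set t := zsum (fun n : int => gauss (1 * (n%:~R)%:C + 0) : R[i]).
have t0 : 0 < cabs t.
  rewrite lt_def cabs_ge0 andbT; apply: contraNneq zsum_gauss_neq0 => /cabs_eq0 h.
  by apply/eqP.
have G1 : 0 < cabs G + 1 by rewrite ltr_wpDl ?cabs_ge0.
have e2 : 0 < e / 2 by rewrite divr_gt0.
have e3 : 0 < e / 2 / (cabs G + 1) * cabs t by rewrite mulr_gt0 ?divr_gt0.
have [K1 h1] := poisson_approx s hl e2.
have [K2 h2] := poisson_approx 0 wedge1 e3.
(* Both approximations are taken at the same K, so the same average [r] occurs: the standard
   Gaussian bounds [1 - r], the given one [P - r * G]. *)
have := h1 (maxn K1 K2) (leq_maxl _ _); have := h2 (maxn K1 K2) (leq_maxr _ _).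
rewrite (_ : zsum (dual_term 1 0) = t); last by apply: eq_zsum => k; rewrite dual_term1.
rewrite mul1r -/t -/P -/G; set r := avg _ _ => a1 a2.
have a3 : cabs (1 - r) <= e / 2 / (cabs G + 1).
  rewrite -(ler_pM2r t0) -cabsM mulrBl mul1r.
  by move: a1.
rewrite (_ : P - G = (P - r * G) - (1 - r) * G); last by ring.
apply: (le_trans (cabsB _ _)); rewrite cabsM.
have : cabs (1 - r) * cabs G <= e / 2 / (cabs G + 1) * (cabs G + 1).
  by apply: ler_pM; rewrite ?cabs_ge0 // lerDl.
by rewrite divfK ?gt_eqF //; lra.
Qed.

End Inversion.

(** * Theta constants *)

Section Theta.
Variable R : realType.
Implicit Types (e f x y t : R) (tau lam : R[i]) (m n k : int).

Lemma theta0E e f tau : theta0 e f tau = zsum (theta_term e f tau).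
Proof. by []. Qed.

Lemma theta_termE e f tau n : theta_term e f tau n =
  cexp ('i%C * (pi * (n%:~R + e / 2) ^+ 2)%:C * tau + 'i%C * (pi * (n%:~R + e / 2) * f)%:C).
Proof.
rewrite /theta_term; congr cexp; case: tau => p q.
by apply/eqP; rewrite eq_complex /=; apply/andP; split; apply/eqP; field.
Qed.

(** Re (-i tau) = Im tau > 0 puts either square root in the double wedge |Im l| < |Re l|; the sign
    then selects the right half. *)
Lemma sqrt_wedge tau : upper tau -> exists2 lam, upper_wedge lam & lam ^+ 2 = - ('i%C * tau).
Proof.
move=> ht; pose l := sqrtc (- ('i%C * tau)).
have hl : l ^+ 2 = - ('i%C * tau) := sqr_sqrtc _.
have hR : Re l ^+ 2 - Im l ^+ 2 = Im tau.
  have : Re (l ^+ 2) = Re (- ('i%C * tau)) by rewrite hl.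
  by case: (l) => p q; case: (tau) => u v /=; rewrite !expr2 => h; lra.
have habs : `|Im l| < `|Re l|.
  rewrite -(@ltr_pXn2r _ 2) ?nnegrE ?normr_ge0 // !real_normK ?num_real //.
  by move: ht; rewrite /upper -hR; lra.
have [r0|r0] := lerP 0 (Re l).
  by exists l => //; rewrite /upper_wedge -[X in _ < X](ger0_norm r0).
exists (- l); last by rewrite sqrrN.
by rewrite /upper_wedge !raddfN /= normrN -[X in _ < X](ltr0_norm r0).
Qed.

(** Completing the square: [w] solves 2 lam w = -i f, so that the cross term becomes the character
    of the theta series. *)
Lemma theta_gauss e f tau lam : lam != 0 -> lam ^+ 2 = - ('i%C * tau) ->
  let w := - ('i%C * (f / 2)%:C / lam) in
  theta_term e f tau =1 (fun n =>
    cexp (pi%:C * w ^+ 2) * gauss (lam * (n%:~R)%:C + (lam * (e / 2)%:C + w))).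
Proof.
move=> l0 hl w n; rewrite theta_termE /gauss -cexpD; congr cexp.
rewrite (_ : lam * (n%:~R)%:C + (lam * (e / 2)%:C + w) = lam * (n%:~R + e / 2)%:C + w); last first.
  by rewrite rmorphD /=; ring.
have hw : lam * w = - ('i%C * (f / 2)%:C) by rewrite /w mulrN mulrC divfK.
rewrite (_ : - (pi%:C * (lam * (n%:~R + e / 2)%:C + w) ^+ 2) =
  - (pi%:C * (lam ^+ 2 * (n%:~R + e / 2)%:C ^+ 2 + 2%:R * (lam * w) * (n%:~R + e / 2)%:C + w ^+ 2)));
  last by ring.
by rewrite hl hw; field.
Qed.

Lemma theta_zdecay e f tau : upper tau -> exists L, zdecay (theta_term e f tau) L.
Proof.
move=> /sqrt_wedge[lam hw hl]; have l0 := wedge_neq0 hw.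
have := gauss_zdecay (lam * (e / 2)%:C + - ('i%C * (f / 2)%:C / lam)) hw.
case=> L hL; exists (cabs (cexp (pi%:C * (- ('i%C * (f / 2)%:C / lam)) ^+ 2)) * L) => n.
by rewrite (theta_gauss e f l0 hl); exact: (zdecayZ _ hL n).
Qed.

(** The dual shift -i s of s = lam e/2 + w is the shift that [theta_gauss] attaches to lam^-1 and
    the characteristic (-f, e). The two Gaussian sums therefore coincide and only constants are
    compared. *)
Lemma theta_inversion e f tau lam : upper_wedge lam -> lam ^+ 2 = - ('i%C * tau) ->
  lam * theta0 e f tau = epi (e * f / 2) * theta0 (- f) e (- tau^-1).
Proof.
move=> hw hl; have l0 := wedge_neq0 hw; have hv := wedgeV hw; have lv0 := wedge_neq0 hv.
have i2 : 'i%C * 'i%C = -1 :> R[i] by rewrite -expr2 sqr_i.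
have iV : 'i%C^-1 = - 'i%C :> R[i].
  have i0 : 'i%C != 0 :> R[i] by rewrite eq_complex /= oner_eq0 andbF.
  by apply: (mulfI i0); rewrite divff // mulrN i2 opprK.
have hl' : lam^-1 ^+ 2 = - ('i%C * - tau^-1).
  by rewrite exprVn hl invrN invfM iV mulNr mulrN.
pose w := - ('i%C * (f / 2)%:C / lam); pose w' := - ('i%C * (e / 2)%:C / lam^-1).
pose s := lam * (e / 2)%:C + w.
have [L hL] := gauss_zdecay s hw.
have [L' hL'] := gauss_zdecay (lam^-1 * (- f / 2)%:C + w') hv.
rewrite !theta0E (eq_zsum (theta_gauss e f l0 hl)) (eq_zsum (theta_gauss (- f) e lv0 hl')).
rewrite -/w -/w' -/s (zsumZ _ hL) (zsumZ _ hL') mulrCA (gauss_inversion s hw).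
have -> : dual_term lam s = fun k => cexp (- (pi%:C * s ^+ 2)) *
    gauss (lam^-1 * (k%:~R)%:C + (lam^-1 * (- f / 2)%:C + w')).
  apply/funext => k; rewrite /dual_term; congr (_ * gauss _).
  congr (_ + _); rewrite /s /w /w' invrK mulNr rmorphN.
  rewrite (_ : - ('i%C * (lam * (e / 2)%:C + - ('i%C * (f / 2)%:C / lam))) =
    ('i%C * 'i%C) * (f / 2)%:C / lam - 'i%C * (e / 2)%:C * lam); last by ring.
  by rewrite i2; ring.
rewrite (zsumZ _ hL') !mulrA; congr (_ * _).
rewrite epiE -!cexpD; congr cexp.
have wl : w * lam = - ('i%C * (f / 2)%:C) by rewrite /w mulNr divfK.
rewrite /s /w' invrK.
rewrite (_ : (pi * (e * f / 2))%:C = pi%:C * (2%:R * (e / 2)%:C * (f / 2)%:C)); last first.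
  by rewrite -(rmorph_nat (real_complex R)) -!rmorphM /=; congr (_%:C); field.
rewrite [LHS](_ : _ =
  - (pi%:C * (lam ^+ 2 * (e / 2)%:C ^+ 2 + 2%:R * (w * lam) * (e / 2)%:C))); last by ring.
rewrite wl [RHS](_ : _ = 'i%C * (pi%:C * (2%:R * (e / 2)%:C * (f / 2)%:C)) +
  pi%:C * ('i%C * 'i%C) * (e / 2)%:C ^+ 2 * lam ^+ 2); last by ring.
by rewrite i2; ring.
Qed.

Lemma theta_charD2 e f tau : upper tau -> theta0 (e + 2) f tau = theta0 e f tau.
Proof.
move=> ht; have [L hL] := theta_zdecay e f ht.
rewrite !theta0E -[RHS](zsum_shift hL); apply: eq_zsum => n.
rewrite !theta_termE (_ : n%:~R + (e + 2) / 2 = (n + 1)%:~R + e / 2) //.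
by rewrite intrD; field.
Qed.

Lemma theta_char_addl e f tau m : upper tau -> theta0 (e + 2 * m%:~R) f tau = theta0 e f tau.
Proof.
move=> ht; have nat_case (n : nat) e' : theta0 (e' + 2 * n%:R) f tau = theta0 e' f tau.
  elim: n => [|n IH]; first by rewrite mulr0 addr0.
  by rewrite (_ : e' + 2 * n.+1%:R = (e' + 2 * n%:R) + 2); [rewrite theta_charD2 | ring].
case: m => n; first by rewrite -pmulrn nat_case.
rewrite NegzE mulrNz -pmulrn -[LHS](nat_case n.+1); congr (theta0 _ f tau).
by rewrite mulrN subrK.
Qed.

Lemma theta_char_addr e f tau n : upper tau ->
  theta0 e (f + 2 * n%:~R) tau = epi (e * n%:~R) * theta0 e f tau.
Proof.
move=> ht; have [L hL] := theta_zdecay e f ht.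
rewrite !theta0E -(zsumZ _ hL); apply: eq_zsum => k.
rewrite !theta_termE -[epi _]mul1r -(epi_2int R (k * n)) -epiD epiE -cexpD; congr cexp.
rewrite [RHS]addrCA; congr (_ + _); rewrite -mulrDr -rmorphD /= intrM; congr (_ * _%:C).
by field.
Qed.

Lemma theta_opp e f tau : upper tau -> theta0 (- e) (- f) tau = theta0 e f tau.
Proof.
move=> ht; have [L hL] := theta_zdecay e f ht.
rewrite !theta0E -[RHS](zsum_opp hL); apply: eq_zsum => n.
rewrite !theta_termE (_ : (- n)%:~R + e / 2 = - (n%:~R + - e / 2)); last first.
  by rewrite mulrNz; field.
by rewrite sqrrN !mulrN !mulNr.
Qed.

Lemma epi_int_sqr n : epi (n%:~R ^+ 2 : R) = epi (n%:~R : R).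
Proof.
have [q hq] : exists q : int, n ^+ 2 = n + 2 * q.
  have [r [->|->]] : exists r : int, n = 2 * r \/ n = 2 * r + 1 by exists (n %/ 2)%Z; lia.
    by exists (r * (2 * r - 1)); ring.
  by exists (r * (2 * r + 1)); ring.
have -> : (n%:~R : R) ^+ 2 = n%:~R + 2 * q%:~R by rewrite -(rmorphXn (intmul 1)) hq rmorphD rmorphM.
by rewrite epiD epi_2int mulr1.
Qed.

(** n^2 and n have the same parity, so e^(pi i (n + e/2)^2) is, up to a constant, a character of
    n. *)
Lemma theta_translate e f tau : upper tau ->
  theta0 e f (tau + 1) = epi (- (e / 2) - e ^+ 2 / 4) * theta0 e (f + 1 + e) tau.
Proof.
move=> ht; have [L hL] := theta_zdecay e (f + 1 + e) ht.
rewrite !theta0E -(zsumZ _ hL); apply: eq_zsum => n.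
rewrite !theta_termE mulrDr mulr1.
have E : epi ((n%:~R + e / 2) ^+ 2) =
    epi (- (e / 2) - e ^+ 2 / 4) * epi ((n%:~R + e / 2) * (1 + e)) :> R[i].
  rewrite -epiD (_ : (n%:~R + e / 2) ^+ 2 = n%:~R ^+ 2 + (n%:~R * e + e ^+ 2 / 4)); last by field.
  by rewrite [LHS]epiD epi_int_sqr -!epiD; congr epi; field.
rewrite addrAC addrC cexpD -epiE E -!mulrA; congr (_ * _).
rewrite epiE -cexpD; congr cexp; rewrite -addrCA; congr (_ + _).
by rewrite -mulrDr -rmorphD; congr (_ * _%:C); ring.
Qed.

(* The normalisation of the theta constants whose transformation under the modular group
   involves no characteristic-dependent phase. *)
Definition theta_klein x y tau : R[i] := epi (- (x * y) - x) * theta0 (1 + 2 * x) (1 + 2 * y) tau.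

Lemma upperD tau x : upper tau -> upper (tau + x%:C).
Proof. by rewrite /upper raddfD /= addr0. Qed.

Lemma klein_translate x y tau : upper tau ->
  theta_klein x y (tau + 1) = epi (1 / 4) * theta_klein x (x + y) tau.
Proof.
move=> ht; rewrite /theta_klein theta_translate //.
rewrite (_ : 1 + 2 * y + 1 + (1 + 2 * x) = 1 + 2 * (x + y) + 2 * 1%:~R); last by rewrite mulr1z; ring.
rewrite theta_char_addr // !mulrA -!epiD; congr (epi _ * _).
by rewrite mulr1z; field.
Qed.

Lemma klein_translate_int x y tau m : upper tau ->
  theta_klein x y (tau + (m%:~R)%:C) = epi (m%:~R / 4) * theta_klein x (m%:~R * x + y) tau.
Proof.
have nat_case (n : nat) y' tau' : upper tau' ->
    theta_klein x y' (tau' + (n%:R)%:C) = epi (n%:R / 4) * theta_klein x (n%:R * x + y') tau'.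
  move=> ht; elim: n y' => [|n IH] y'; first by rewrite rmorph0 addr0 mul0r epi0 mul1r mul0r add0r.
  rewrite -natr1 rmorphD rmorph1 addrA klein_translate; last exact: upperD.
  by rewrite IH mulrA -epiD; congr (epi _ * theta_klein _ _ _); field.
move=> ht; case: m => n; first by rewrite -pmulrn nat_case.
rewrite NegzE mulrNz -pmulrn.
have ht' : upper (tau + (- n.+1%:R)%:C) by exact: upperD.
(* For a negative translation the positive case is used at the translated point and solved for the
   value there. *)
have := nat_case n.+1 (- n.+1%:R * x + y) _ ht'.
rewrite -addrA -rmorphD addNr rmorph0 addr0 => ->.
rewrite mulrA -epiD (_ : - n.+1%:R / 4 + n.+1%:R / 4 = 0); last by ring.
by rewrite epi0 mul1r; congr (theta_klein _ _ _); ring.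
Qed.

(** [theta_inversion] at the characteristic (1 + 2y, -1 - 2x). Bringing -1 - 2x back to 1 - 2x costs
    a phase, which the normalisations on both sides reduce to a constant. *)
Lemma klein_inversion x y tau lam : upper tau -> upper_wedge lam -> lam ^+ 2 = - ('i%C * tau) ->
  theta_klein x y (- tau^-1) = lam * epi (- (1 / 2)) * theta_klein y (- x) tau.
Proof.
move=> ht hw hl; have := theta_inversion (1 + 2 * y) (- 1 - 2 * x) hw hl.
rewrite (_ : - (- 1 - 2 * x) = 1 + 2 * x); last by ring.
rewrite (_ : - 1 - 2 * x = 1 + 2 * (- x) + 2 * (-1)%:~R); last by rewrite mulrNz mulr1z; ring.
rewrite theta_char_addr // => h.
set c := _ / 2 in h; rewrite /theta_klein.
have -> : theta0 (1 + 2 * x) (1 + 2 * y) (- tau^-1) =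
    epi (- c) * (lam * (epi ((1 + 2 * y) * (-1)%:~R) * theta0 (1 + 2 * y) (1 + 2 * - x) tau)).
  by rewrite h mulrA -epiD addNr epi0 mul1r.
set t := theta0 _ _ _.
rewrite (_ : _ * (_ * _) = lam * (epi (- (x * y) - x) * epi (- c) * epi ((1 + 2 * y) * (-1)%:~R)) * t);
  last by ring.
rewrite [RHS](_ : _ = lam * (epi (- (1 / 2)) * epi (- (y * - x) - y)) * t); last by ring.
by rewrite -!epiD; congr (_ * epi _ * _); rewrite /c mulrNz mulr1z; field.
Qed.

Lemma klein_opp x y tau : upper tau -> theta_klein (- x) (- y) tau = - theta_klein x y tau.
Proof.
move=> ht; rewrite /theta_klein.
rewrite (_ : 1 + 2 * - x = - (1 + 2 * x) + 2 * 1%:~R); last by rewrite mulr1z; ring.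
rewrite (_ : 1 + 2 * - y = - (1 + 2 * y) + 2 * 1%:~R); last by rewrite mulr1z; ring.
rewrite theta_char_addl // theta_char_addr // theta_opp // [LHS]mulrA -[RHS]mulNr; congr (_ * _).
rewrite -mulN1r -epi1 -!epiD mulr1z.
rewrite (_ : - (- x * - y) - - x + - (1 + 2 * x) * 1 = 1 + (- (x * y) - x) + 2 * (-1)%:~R).
  by rewrite [LHS]epiD epi_2int mulr1.
by rewrite mulrNz mulr1z; ring.
Qed.

Lemma klein_period x y m n tau : upper tau ->
  theta_klein (x + m%:~R) (y + n%:~R) tau =
  epi (x * n%:~R - m%:~R * y - m%:~R * n%:~R - m%:~R + n%:~R) * theta_klein x y tau.
Proof.
move=> ht; rewrite /theta_klein.
rewrite !mulrDr !addrA theta_char_addl // theta_char_addr // !mulrA -!epiD; congr (epi _ * _).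
by ring.
Qed.

End Theta.

(** * The modular group *)

Section Modular.
Variable R : realType.
Implicit Types (x y t : R) (tau lam : R[i]) (a b c d m n k : int).

Definition eta_exponent a b c d : int :=
  if odd `|c|%N then (a + d) * c - b * d * (c ^+ 2 - 1) - 3 * c
  else (a + d) * c - b * d * (c ^+ 2 - 1) + 3 * d - 3 - 3 * c * d.

(** The fourth root of unity e^(pi i E / 2) depends on E modulo 4 only, and the parity of c survives
    in Z/4 as the test 2c = 2; the whole exponent is thus a function on Z/4. *)
Definition eta_exponent_mod4 (a b c d : 'Z_4) : 'Z_4 :=
  if 2 * c == 2 then (a + d) * c - b * d * (c ^+ 2 - 1) - 3 * c
  else (a + d) * c - b * d * (c ^+ 2 - 1) + 3 * d - 3 - 3 * c * d.

Lemma eq0_mod4 n : (n%:~R == 0 :> 'Z_4) = (4 %| n)%Z.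
Proof.
have nat_case (p : nat) : (p%:R == 0 :> 'Z_4) = (4 %| p)%N.
  by rewrite -Zp_nat_mod // -val_eqE /= val_Zp_nat ?modn_mod.
case: n => p; first by rewrite -pmulrn nat_case.
by rewrite NegzE mulrNz oppr_eq0 -pmulrn nat_case dvdzE abszN.
Qed.

Lemma odd_mod4 c : odd `|c|%N = (2 * c%:~R == 2 :> 'Z_4).
Proof.
rewrite -subr_eq0 -[2 * _ - 2]/(2%:~R * c%:~R - 2%:~R) -intrM -rmorphB /= eq0_mod4.
lia.
Qed.

Lemma eta_exponent_modE a b c d :
  (eta_exponent a b c d)%:~R = eta_exponent_mod4 a%:~R b%:~R c%:~R d%:~R.
Proof.
rewrite /eta_exponent /eta_exponent_mod4 -odd_mod4; case: ifP => _.
  by rewrite !(rmorphB, rmorphD, rmorphM, rmorphXn).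
by rewrite !(rmorphB, rmorphD, rmorphM, rmorphXn).
Qed.

Definition Z4 : seq 'Z_4 := [:: 0; 1; 2; 3].

Lemma mem_Z4 (x : 'Z_4) : x \in Z4.
Proof. by case: x => [[|[|[|[|x]]]] hx]. Qed.

Lemma Z4P (P : pred 'Z_4) : all P Z4 -> forall z : 'Z_4, P z.
Proof. by move=> /allP h x; apply: h; exact: mem_Z4. Qed.

(** Cocycle rule for right multiplication by the translation by m, decided by enumerating Z/4;
    [eta_mod4_inversion] does the same for tau -> -1/tau. *)
Lemma eta_mod4_translate (a b c d m : 'Z_4) : a * d - b * c = 1 ->
  eta_exponent_mod4 a (m * a + b) c (m * c + d) = eta_exponent_mod4 a b c d + m.
Proof.
have h : all (fun a : 'Z_4 => all (fun b : 'Z_4 => all (fun c : 'Z_4 => all (fun d : 'Z_4 => all (fun m : 'Z_4 =>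
  (a * d - b * c == 1) ==>
  (eta_exponent_mod4 a (m * a + b) c (m * c + d) == eta_exponent_mod4 a b c d + m))
  Z4) Z4) Z4) Z4) Z4 by vm_compute.
move=> /eqP e; apply/eqP; move: e; apply/implyP.
by move: m; apply: Z4P; move: d; apply: Z4P; move: c; apply: Z4P; move: b; apply: Z4P; move: a; apply: Z4P.
Qed.

Lemma eta_mod4_inversion (a b c d : 'Z_4) : a * d - b * c = 1 ->
  eta_exponent_mod4 b (- a) d (- c) = eta_exponent_mod4 a b c d + 1.
Proof.
have h : all (fun a : 'Z_4 => all (fun b : 'Z_4 => all (fun c : 'Z_4 => all (fun d : 'Z_4 =>
  (a * d - b * c == 1) ==>
  (eta_exponent_mod4 b (- a) d (- c) == eta_exponent_mod4 a b c d + 1))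
  Z4) Z4) Z4) Z4 by vm_compute.
move=> /eqP e; apply/eqP; move: e; apply/implyP.
by move: d; apply: Z4P; move: c; apply: Z4P; move: b; apply: Z4P; move: a; apply: Z4P.
Qed.

Lemma epi_quarter k n : (k%:~R = n%:~R :> 'Z_4) -> epi (k%:~R / 2) = epi (n%:~R / 2) :> R[i].
Proof.
move/eqP; rewrite -subr_eq0 -rmorphB /= eq0_mod4 => /dvdzP[q hq].
have -> : k = n + q * 4 by rewrite -hq; ring.
rewrite (_ : (n + q * 4)%:~R / 2 = n%:~R / 2 + 2 * q%:~R); first by rewrite epiD epi_2int mulr1.
by rewrite rmorphD rmorphM /=; field.
Qed.

Lemma det_mod4 a b c d : a * d - b * c = 1 ->
  a%:~R * d%:~R - b%:~R * c%:~R = 1 :> 'Z_4.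
Proof. by move=> h; rewrite -!rmorphM -rmorphB h. Qed.

Lemma legendre_sqr a (p : nat) : ~~ (p%:Z %| a)%Z -> legendre a p ^+ 2 = 1.
Proof. by rewrite /legendre => /negPf ->; case: ifP. Qed.

Lemma jacobi_sqr a (n : nat) : coprimez a n -> jacobi a n ^+ 2 = 1.
Proof.
move=> co; rewrite /jacobi -prodrXl big_seq big1 // => p.
rewrite mem_primes => /and3P[pp n0 pn].
rewrite exprAC legendre_sqr ?expr1n //.
apply/negP => pa; have : (p %| gcdn `|a| n)%N by rewrite dvdn_gcd pn andbT.
by move: co; rewrite coprimezE /coprime /= => /eqP ->; rewrite dvdn1; apply/negP; case: eqP pp => // ->.
Qed.

(** Coprimality of c and d makes the Jacobi symbols signs, which an even power removes; the sixth
    power turns the denominator 12 into 2. *)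
Lemma nu_eta6 a b c d : a * d - b * c = 1 ->
  nu_eta R a b c d ^+ 6 = epi ((eta_exponent a b c d)%:~R / 2).
Proof.
move=> hd.
have cd : coprimez d c.
  by apply/coprimezP; exists (a, - b); rewrite /= -hd; ring.
have unit6 (u : int) : u ^+ 2 = 1 -> (u%:~R : R[i]) ^+ 6 = 1.
  by move=> h; rewrite (exprM _ 2 3) -(rmorphXn (intmul 1)) h expr1n.
have six t : epi (t / 12) ^+ 6 = epi (t / 2) :> R[i].
  by rewrite epiX; congr epi; rewrite -mulr_natr; field.
rewrite /nu_eta /eta_exponent; case: ifP => hc; rewrite exprMn six unit6 ?mul1r //.
  by rewrite /jac_up jacobi_sqr // coprimezE /= -coprimezE.
rewrite /jac_down exprMn jacobi_sqr; last by rewrite coprimezE /= coprime_sym -coprimezE.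
by case: ifP; rewrite mul1r.
Qed.

Definition klein2 (v w : R * R) tau : R[i] := theta_klein v.1 v.2 tau * theta_klein w.1 w.2 tau.

Definition rowmul a b c d (v : R * R) : R * R :=
  (a%:~R * v.1 + c%:~R * v.2, b%:~R * v.1 + d%:~R * v.2).

(** Quantified over [tau] because a generator multiplied on the right of M is handled by using the
    law of M at the transformed point. *)
Definition modular_law a b c d := forall v w tau, upper tau ->
  klein2 v w (mobius a b c d tau) =
  epi ((eta_exponent a b c d)%:~R / 2) * (c%:~R * tau + d%:~R) *
  klein2 (rowmul a b c d v) (rowmul a b c d w) tau.

Lemma upper_denom c d tau : upper tau -> (c != 0) || (d != 0) -> c%:~R * tau + d%:~R != 0.
Proof.
move=> ht; have [-> /= d0|c0 _] := eqVneq c 0; first by rewrite mul0r add0r intr_eq0.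
apply/eqP => h; have : Im (c%:~R * tau + d%:~R) = c%:~R * Im tau.
  rewrite -!(rmorph_int (real_complex R)) /=; case: (tau) => p q /=; ring.
rewrite h /= => /esym/eqP; rewrite mulf_eq0 intr_eq0 (negPf c0) /= => /eqP h0.
by move: ht; rewrite /upper h0 ltxx.
Qed.

Lemma upper_neq0 tau : upper tau -> tau != 0.
Proof. by move=> ht; apply: contraPneq ht => ->; rewrite /upper ltxx. Qed.

Lemma upper_inversion tau : upper tau -> upper (- tau^-1).
Proof.
rewrite /upper; case: tau => p q /= q0.
by rewrite opprK divr_gt0 // ltr_wpDl ?sqr_ge0 // exprn_gt0.
Qed.

Lemma det_neq0 a b c d : a * d - b * c = 1 -> (c != 0) || (d != 0).
Proof. by move=> h; apply/orP; case: (eqVneq c 0) h => [->|]; [right; lia | left]. Qed.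

Lemma modular_law1 : modular_law 1 0 0 1.
Proof.
move=> [x1 y1] [x2 y2] tau ht; rewrite /mobius /eta_exponent /rowmul /=.
rewrite (_ : (1 + 1) * 0 - _ + 3 * 1 - 3 - 3 * 0 * 1 = 0 :> int); last by ring.
by rewrite !(mulr0z, mulr1z) !mul0r !mul1r epi0 !(add0r, addr0) divr1 !mul1r.
Qed.

Lemma modular_law_translate a b c d m : a * d - b * c = 1 ->
  modular_law a b c d -> modular_law a (m * a + b) c (m * c + d).
Proof.
move=> hdet h v w tau ht.
have ht' : upper (tau + (m%:~R)%:C) by exact: upperD.
have -> : mobius a (m * a + b) c (m * c + d) tau = mobius a b c d (tau + (m%:~R)%:C).
  by rewrite /mobius !rmorphD !rmorphM /= rmorph_int; congr (_ / _); ring.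
rewrite (h v w _ ht') /klein2 !klein_translate_int // /rowmul /=.
have -> : epi ((eta_exponent a (m * a + b) c (m * c + d))%:~R / 2) =
   epi ((eta_exponent a b c d)%:~R / 2) * epi (m%:~R / 2) :> R[i].
  rewrite -epiD -mulrDl -rmorphD; apply: epi_quarter.
  rewrite intrD !eta_exponent_modE !intrD !intrM.
  exact: eta_mod4_translate (det_mod4 hdet).
rewrite (_ : m%:~R / 2 = m%:~R / 4 + m%:~R / 4); last by field.
rewrite epiD rmorphD rmorphM /= (rmorph_int (real_complex R)).
have eq2 (u : R * R) : m%:~R * (a%:~R * u.1 + c%:~R * u.2) + (b%:~R * u.1 + d%:~R * u.2) =
   (m * a + b)%:~R * u.1 + (m * c + d)%:~R * u.2 by rewrite !rmorphD !rmorphM /=; ring.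
by rewrite !eq2; ring.
Qed.

(** The two inversions contribute lam^2 e^(-pi i) = i tau, and (d - c / tau) i tau = i (d tau - c);
    the factor i is the increment of the exponent by 1. *)
Lemma modular_law_inversion a b c d : a * d - b * c = 1 ->
  modular_law a b c d -> modular_law b (- a) d (- c).
Proof.
move=> hdet h v w tau ht; have t0 := upper_neq0 ht.
have ht' := upper_inversion ht.
have [lam hw hl] := sqrt_wedge ht.
have den := upper_denom ht' (det_neq0 hdet).
have -> : mobius b (- a) d (- c) tau = mobius a b c d (- tau^-1).
  rewrite /mobius !rmorphN /=; field.
  rewrite t0 /=; move: den; apply: contra => /eqP den0.
  apply/eqP; apply: (mulIf t0); rewrite mul0r mulrDl mulrN mulNr mulfVK //.
  by rewrite -den0; ring.
rewrite (h v w _ ht') /klein2 !(klein_inversion _ _ ht hw hl) /rowmul /=.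
have -> : epi ((eta_exponent b (- a) d (- c))%:~R / 2) =
   epi ((eta_exponent a b c d)%:~R / 2) * epi (1 / 2) :> R[i].
  rewrite -epiD -mulrDl -[1 in X in _ = epi X]/(1%:~R) -rmorphD; apply: epi_quarter.
  rewrite intrD !eta_exponent_modE !mulrNz.
  exact: eta_mod4_inversion (det_mod4 hdet).
have eq2 (u : R * R) : - (a%:~R * u.1 + c%:~R * u.2) =
   (- a)%:~R * u.1 + (- c)%:~R * u.2 by rewrite !rmorphN /=; ring.
rewrite !eq2 rmorphN.
set A := theta_klein _ _ _; set B := theta_klein _ _ _; set E := epi (_%:~R / 2).
rewrite [LHS](_ : _ =
  E * (c%:~R * - tau^-1 + d%:~R) * (lam ^+ 2 * epi (- (1 / 2)) ^+ 2) * (A * B)); last by ring.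
rewrite hl epiX (_ : - (1 / 2) *+ 2 = -1); last by rewrite -mulr_natr; field.
by rewrite epiN epi1 invrN invr1 epi_half mulrNz; field.
Qed.

Lemma modular_law_SL2 a b c d : a * d - b * c = 1 -> modular_law a b c d.
Proof.
move: {2}(`|c|%N) (leqnn `|c|%N) => n; elim: n a b c d => [|n IH] a b c d hc hdet.
  have c0 : c = 0 by lia.
  have i1 : 1 * 1 - 0 * 0 = 1 :> int by lia.
  have i2 : 0 * 0 - (-1) * 1 = 1 :> int by lia.
  have i3 : (-1) * (-1) - 0 * 0 = 1 :> int by lia.
  (* -I is the square of the inversion. *)
  have mI : modular_law (-1) 0 0 (-1).
    have := modular_law_inversion i1 modular_law1; rewrite oppr0 => h.
    by have := modular_law_inversion i2 h; rewrite oppr0.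
  have [[ha hd]|[ha hd]] : (a = 1 /\ d = 1) \/ (a = -1 /\ d = -1).
    rewrite c0 mulr0 subr0 in hdet; have := congr1 absz hdet; rewrite abszM => /eqP.
    by rewrite muln_eq1 => /andP[/eqP h1 /eqP h2]; have : a = d \/ a = - d; [lia | case => e; move: hdet; rewrite e; lia].
  - have := modular_law_translate b i1 modular_law1.
    by rewrite mulr1 mulr0 addr0 add0r ha hd c0.
  - have := modular_law_translate (- b) i3 mI.
    by rewrite mulrNN mulr1 mulr0 addr0 add0r ha hd c0.
have [c0|c0] := eqVneq c 0; first by apply: IH => //; rewrite c0.
(* M = M' S T^m, where S is the inversion, T the unit translation and M' has bottom row (m c - d,
   c); its first entry is minus the remainder of d by c, smaller than c in absolute value. *)
pose m := (d %/ c)%Z; have hm := divz_eq d c.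
have r0 : 0 <= (d %% c)%Z by exact: modz_ge0.
have r1 := ltz_mod d c0.
have := IH (m * a - b) a (m * c - d) c.
rewrite -/m in hm; have hdet' : (m * a - b) * c - a * (m * c - d) = 1 by rewrite -hdet; ring.
have hn : leq `|(m * c - d)%R| n.
  have -> : m * c - d = - (d %% c)%Z by rewrite [X in _ - X]hm; ring.
  by rewrite abszN; lia.
move=> /(_ hn hdet') h.
have := modular_law_translate m _ (modular_law_inversion hdet' h).
rewrite (_ : m * a + - (m * a - b) = b); last by ring.
rewrite (_ : m * c + - (m * c - d) = d); last by ring.
by apply; rewrite -hdet; ring.
Qed.

End Modular.

(** * Characteristics with denominator 5 and the group Gamma_(theta,5) *)

Section Main.
Variable R : realType.
Implicit Types (x y : R) (tau : R[i]) (a b c d : int).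

Definition fifth : R := 1 / 5.

Definition klein_fifths tau : R[i] := klein2 (- fifth, - fifth) (- fifth, fifth) tau.

(** 3/5 = 1 - 2/5 and 7/5 = 1 + 2/5; in the product of the two normalisations the terms xy cancel
    and the terms x leave the exponent 2/5. *)
Lemma Qfun_klein tau : Qfun tau = epi (- 2 / 5) * klein_fifths tau.
Proof.
rewrite /Qfun /klein_fifths /klein2 /theta_klein /=.
rewrite (_ : 1 + 2 * - fifth = 3 / 5); last by rewrite /fifth; field.
rewrite (_ : 1 + 2 * fifth = 7 / 5); last by rewrite /fifth; field.
set s := theta0 _ _ _; set t := theta0 _ _ _; set e1 := epi (- (- fifth * - fifth) - _).
set e2 := epi (- (- fifth * fifth) - _).
rewrite (_ : _ * (_ * _ * _) = (epi (- 2 / 5) * e1 * e2) * (s * t)); last by ring.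
rewrite /e1 /e2 -!epiD [in epi _](_ : _ + _ = 0) ?epi0 ?mul1r //.
by rewrite /fifth; field.
Qed.

Lemma cong5P (u v : int) : cong5 u v -> exists q, u = v + 5 * q.
Proof.
rewrite /cong5 eqz_mod_dvd => /dvdzP[q hq]; exists q.
by rewrite mulrC -hq; ring.
Qed.

Lemma cong5_excl (u v w : int) : cong5 u v -> ~~ cong5 v w -> cong5 u w = false.
Proof. by rewrite /cong5 => /eqP -> /negPf. Qed.

Lemma epi_mod2 x y (k : int) : x = y + 2 * k%:~R -> epi x = epi y :> R[i].
Proof. by move=> ->; rewrite epiD epi_2int mulr1. Qed.

(** The sign is written as a phase so that it merges with the phases of [klein_period]. *)
Lemma klein_opp_epi x y tau : upper tau ->
  theta_klein (- x) (- y) tau = epi 1 * theta_klein x y tau.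
Proof. by move=> ht; rewrite klein_opp // epi1 mulN1r. Qed.

(** With v and w the two vectors of [klein_fifths], vM - v and wM - w are integral, and E comes from
    the phases of [klein_period]. *)
Lemma klein_fifths_caseI a b c d tau : upper tau -> congI a b c d ->
  klein2 (rowmul a b c d (- fifth, - fifth)) (rowmul a b c d (- fifth, fifth)) tau
  = epi (E_exp R a b c d / 5) * klein_fifths tau.
Proof.
move=> ht hI; rewrite /E_exp hI; case/and4P: hI.
move=> /cong5P[al ->] /cong5P[be ->] /cong5P[ga ->] /cong5P[de ->].
rewrite /klein_fifths /klein2 /rowmul /=.
rewrite (_ : _ * - fifth + _ * - fifth = - fifth + (- (al + ga))%:~R); last first.
  by rewrite /fifth !(rmorphD, rmorphN, rmorphM) /=; field.
rewrite (_ : _ * - fifth + _ * - fifth = - fifth + (- (be + de))%:~R); last first.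
  by rewrite /fifth !(rmorphD, rmorphN, rmorphM) /=; field.
rewrite (_ : _ * - fifth + _ * fifth = - fifth + (ga - al)%:~R); last first.
  by rewrite /fifth !(rmorphD, rmorphN, rmorphM) /=; field.
rewrite (_ : _ * - fifth + _ * fifth = fifth + (de - be)%:~R); last first.
  by rewrite /fifth !(rmorphD, rmorphN, rmorphM) /=; field.
rewrite !klein_period // mulrACA -epiD; congr (_ * _).
(* The witness is half the difference of the two exponents, found by expanding both in [al], [be],
   [ga], [de]. *)
apply: (@epi_mod2 _ _ al).
by rewrite /fifth !(rmorphD, rmorphN, rmorphM) /=; field.
Qed.

(** Modulo integers vM = -v and wM = -w; the two signs cancel. *)
Lemma klein_fifths_casemI a b c d tau : upper tau -> congmI a b c d ->
  klein2 (rowmul a b c d (- fifth, - fifth)) (rowmul a b c d (- fifth, fifth)) tau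
  = epi (E_exp R a b c d / 5) * klein_fifths tau.
Proof.
move=> ht hI; have hA : congI a b c d = false.
  by case/and4P: hI => ha _ _ _; rewrite /congI (cong5_excl ha).
rewrite /E_exp hA hI {hA}; case/and4P: hI.
move=> /cong5P[al ->] /cong5P[be ->] /cong5P[ga ->] /cong5P[de ->].
rewrite /klein_fifths /klein2 /rowmul /=.
rewrite (_ : _ * - fifth + _ * - fifth = - (- fifth) + (- (al + ga))%:~R); last first.
  by rewrite /fifth !(rmorphD, rmorphN, rmorphM) /=; field.
rewrite (_ : _ * - fifth + _ * - fifth = - (- fifth) + (- (be + de))%:~R); last first.
  by rewrite /fifth !(rmorphD, rmorphN, rmorphM) /=; field.
rewrite (_ : _ * - fifth + _ * fifth = - (- fifth) + (ga - al)%:~R); last first.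
  by rewrite /fifth !(rmorphD, rmorphN, rmorphM) /=; field.
rewrite (_ : _ * - fifth + _ * fifth = - fifth + (de - be)%:~R); last first.
  by rewrite /fifth !(rmorphD, rmorphN, rmorphM) /=; field.
rewrite !klein_period // !klein_opp // mulrACA mulrNN -epiD; congr (_ * _).
apply: (@epi_mod2 _ _ (al + be)).
by rewrite /fifth !(rmorphD, rmorphN, rmorphM) /=; field.
Qed.

(** Modulo integers vM = w and wM = -v; the single sign accounts for the term -5 in E. *)
Lemma klein_fifths_caseS a b c d tau : upper tau -> congS a b c d ->
  klein2 (rowmul a b c d (- fifth, - fifth)) (rowmul a b c d (- fifth, fifth)) tau
  = epi (E_exp R a b c d / 5) * klein_fifths tau.
Proof.
move=> ht hI; have [hA hB] : congI a b c d = false /\ congmI a b c d = false.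
  by case/and4P: hI => ha _ _ _; rewrite /congI /congmI !(cong5_excl ha).
rewrite /E_exp hA hB hI {hA hB}; case/and4P: hI.
move=> /cong5P[al ->] /cong5P[be ->] /cong5P[ga ->] /cong5P[de ->].
rewrite /klein_fifths /klein2 /rowmul /=.
rewrite (_ : _ * - fifth + _ * - fifth = - fifth + (- (al + ga))%:~R); last first.
  by rewrite /fifth !(rmorphD, rmorphN, rmorphM) /=; field.
rewrite (_ : _ * - fifth + _ * - fifth = fifth + (- (be + de))%:~R); last first.
  by rewrite /fifth !(rmorphD, rmorphN, rmorphM) /=; field.
rewrite (_ : _ * - fifth + _ * fifth = - (- fifth) + (ga - al)%:~R); last first.
  by rewrite /fifth !(rmorphD, rmorphN, rmorphM) /=; field.
rewrite (_ : _ * - fifth + _ * fifth = - (- fifth) + (de - be)%:~R); last first.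
  by rewrite /fifth !(rmorphD, rmorphN, rmorphM) /=; field.
rewrite !klein_period // klein_opp_epi // [epi _ * (epi 1 * _)]mulrA -epiD mulrACA -epiD.
rewrite (mulrC (theta_klein (- fifth) fifth tau)); congr (_ * _).
apply: (@epi_mod2 _ _ (1 + de + al - be)).
by rewrite /fifth !(rmorphD, rmorphN, rmorphM) /=; field.
Qed.

(** Modulo integers vM = -w and wM = v, again with a single sign. *)
Lemma klein_fifths_casemS a b c d tau : upper tau -> congmS a b c d ->
  klein2 (rowmul a b c d (- fifth, - fifth)) (rowmul a b c d (- fifth, fifth)) tau
  = epi (E_exp R a b c d / 5) * klein_fifths tau.
Proof.
move=> ht hI; have [hA hB hC] : [/\ congI a b c d = false, congmI a b c d = false & congS a b c d = false].
  case/and4P: hI => ha hb _ _; split; first by rewrite /congI (cong5_excl ha).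
    by rewrite /congmI (cong5_excl ha).
  by rewrite /congS (cong5_excl hb) // andbF.
rewrite /E_exp hA hB hC {hA hB hC}; case/and4P: hI.
move=> /cong5P[al ->] /cong5P[be ->] /cong5P[ga ->] /cong5P[de ->].
rewrite /klein_fifths /klein2 /rowmul /=.
rewrite (_ : _ * - fifth + _ * - fifth = - (- fifth) + (- (al + ga))%:~R); last first.
  by rewrite /fifth !(rmorphD, rmorphN, rmorphM) /=; field.
rewrite (_ : _ * - fifth + _ * - fifth = - fifth + (- (be + de))%:~R); last first.
  by rewrite /fifth !(rmorphD, rmorphN, rmorphM) /=; field.
rewrite (_ : _ * - fifth + _ * fifth = - fifth + (ga - al)%:~R); last first.
  by rewrite /fifth !(rmorphD, rmorphN, rmorphM) /=; field.
rewrite (_ : _ * - fifth + _ * fifth = - fifth + (de - be)%:~R); last first.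
  by rewrite /fifth !(rmorphD, rmorphN, rmorphM) /=; field.
rewrite !klein_period // klein_opp_epi // [epi _ * (epi 1 * _)]mulrA -epiD mulrACA -epiD.
rewrite (mulrC (theta_klein (- fifth) fifth tau)); congr (_ * _).
apply: (@epi_mod2 _ _ (1 - de + al - be)).
by rewrite /fifth !(rmorphD, rmorphN, rmorphM) /=; field.
Qed.

Lemma Qfun_modular a b c d tau : Gamma_theta5 a b c d -> upper tau ->
  Qfun (mobius a b c d tau) = nu R a b c d * (c%:~R * tau + d%:~R) * Qfun tau.
Proof.
move=> [hdet hM] ht; rewrite !Qfun_klein /klein_fifths (modular_law_SL2 hdet) // /nu nu_eta6 //.
have -> : klein2 (rowmul a b c d (- fifth, - fifth)) (rowmul a b c d (- fifth, fifth)) tau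
  = epi (E_exp R a b c d / 5) * klein_fifths tau.
  case: hM => [h|[h|[h|h]]].
  - exact: klein_fifths_caseI.
  - exact: klein_fifths_casemI.
  - exact: klein_fifths_caseS.
  - exact: klein_fifths_casemS.
by rewrite /klein_fifths; ring.
Qed.

End Main.

Theorem mainTheorem8 (R : realType) (a b c d : int) (tau : R[i]) :
  Gamma_theta5 a b c d -> upper tau ->
  Qfun (mobius a b c d tau) = nu R a b c d * (c%:~R * tau + d%:~R) * Qfun tau.
Proof. exact: Qfun_modular. Qed.
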